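(* Let $\beta\in(0,\tfrac14)$, let $X_1,\dots,X_n$ be i.i.d. on $[0,1]$ with density $f\in H(\beta)$, and let $k_1\le k_2\le k_3$ satisfy $k_1\sim n$, $\ n^{(3/2-2\beta)/(1+4\beta)}\le k_2\le n^{(3/2+2\beta)/(1+4\beta)}$, and $k_3\sim n^{2/(1+4\beta)}$. Let $\hat\phi_{k_1,k_2,k_3}$ be the third order U-statistic defined in the context, with projection kernels based on the Haar basis. Then for every fixed $q\ge 1$ and all sufficiently large $n$, $$\mathbb E_f\Big(\hat\phi_{k_1,k_2,k_3}-\mathbb E_f\big(\hat\phi_{k_1,k_2,k_3}\big)\Big)^{2q}\le c\Big(\frac{k_3}{n^2}\Big)^q ,$$ where the constant $c$ depends only on $q$, on (a majorant of) the Haar father and mother functions, on $\|f\|_\infty$ and on $f_{\min}=\inf_{x\in[0,1]}f(x)$ (and on the constants implicit in the relations $\sim$).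
   Context: Fix a radius $C>0$ and constants $0<M_*<M^*$. For $\beta\in(0,1)$, the Hölder ball $H(\beta,C)$ is the set of functions $h$ on $[0,1]$ with $|h|\le C$ and $|h(x)-h(y)|\le C|x-y|^{\beta}$ for all $x,y$. $H(\beta)$ denotes the set of probability densities $f\in H(\beta,C)$ on $[0,1]$ with $M_*\le f\le M^*$. $\mathbb E_f$ is expectation when $X_1,\dots,X_n$ are i.i.d. with density $f$. $a\sim b$ means equality up to multiplicative constants bounded above and below. Haar projection kernel: truncation levels are understood to be powers of two (otherwise rounded up to the next power of two), and for such $k$ $$K_k(x,y)=k\sum_{j=1}^{k}\mathbf 1\big\{x\in(\tfrac{j-1}{k},\tfrac jk]\big\}\mathbf 1\big\{y\in(\tfrac{j-1}{k},\tfrac jk]\big\}.$$ For a function $h$ of three variables, $\mathbb V_n[h(X_{i_1},X_{i_2},X_{i_3})]=\frac1{n(n-1)(n-2)}\sum h(X_{i_1},X_{i_2},X_{i_3})$, the sum being over all triples of pairwise distinct indices in $\{1,\dots,n\}$. Writing $K_a^{i}=K_{k_a}(x,X_{i})$ for $a=1,2,3$, $$\begin{aligned}\hat\phi_{k_1,k_2,k_3}=\ &\mathbb V_n\Big[\int_0^1 K_1^{i_1}K_1^{i_2}K_1^{i_3}dx\Big]+3\,\mathbb V_n\Big[\int_0^1 K_1^{i_1}(K_3^{i_2}-K_1^{i_2})K_1^{i_3}dx\Big]\\&+3\,\mathbb V_n\Big[\int_0^1 K_1^{i_1}(K_3^{i_2}-K_1^{i_2})(K_3^{i_3}-K_1^{i_3})dx\Big]\\&+3\,\mathbb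 V_n\Big[\int_0^1 (K_2^{i_1}-K_1^{i_1})(K_2^{i_2}-K_1^{i_2})(K_3^{i_3}-K_2^{i_3})dx\Big]\\&+\mathbb V_n\Big[\int_0^1 (K_2^{i_1}-K_1^{i_1})(K_2^{i_2}-K_1^{i_2})(K_2^{i_3}-K_1^{i_3})dx\Big].\end{aligned}$$ *)

(* Defs.v *)
From HB Require Import structures.
From mathcomp Require Import all_boot all_order all_algebra.
From mathcomp Require Import all_classical all_reals all_analysis.

Set Implicit Arguments.
Unset Strict Implicit.
Unset Printing Implicit Defensive.

Import Order.TTheory GRing.Theory Num.Theory.
Import numFieldNormedType.Exports.

Local Open Scope classical_set_scope.
Local Open Scope ring_scope.

Section HoelderDensities.
Context {R : realType}.

(* Functions on [0,1] are represented by functions on R of which only the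
   values on [0,1] matter. *)
Definition hoelder_ball (beta C : R) (h : R -> R) : Prop :=
  (forall x : R, x \in `[0, 1] -> `|h x| <= C) /\
  (forall x y : R, x \in `[0, 1] -> y \in `[0, 1] ->
     `|h x - h y| <= C * `|x - y| `^ beta).

Definition hoelder_densities (beta C Mlow Mup : R) : set (R -> R) :=
  [set f | [/\ hoelder_ball beta C f,
               forall x : R, x \in `[0, 1] -> Mlow <= f x <= Mup &
               (\int[@lebesgue_measure R]_(x in `[0%R, 1%R]) (f x)%:E = 1)%E]].

Definition sup_norm01 (f : R -> R) : R :=
  sup [set `|f x| | x in `[0, 1]%classic].

Definition inf01 (f : R -> R) : R := inf [set f x | x in `[0, 1]%classic].

End HoelderDensities.

Section Sampling.
Context {d : measure_display} {T : measurableType d} {R : realType}.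
Variable P : probability T R.

Definition mutually_independent (n : nat) (X : 'I_n -> {RV P >-> R}) : Prop :=
  forall (J : {set 'I_n}) (B : 'I_n -> set R),
    (forall i, i \in J -> measurable (B i)) ->
    P (\bigcap_(i in [set` J]) (X i @^-1` B i)) =
    (\prod_(i in J) P (X i @^-1` B i))%E.

Definition has_density01 (f : R -> R) (X : {RV P >-> R}) : Prop :=
  forall A : set R, measurable A ->
    (distribution P X A =
     \int[@lebesgue_measure R]_(x in A `&` `[0%R, 1%R]) (f x)%:E)%E.

Definition iid_density01 (f : R -> R) (n : nat) (X : 'I_n -> {RV P >-> R}) :
    Prop :=
  mutually_independent X /\ (forall i, has_density01 f (X i)).

End Sampling.

Section Estimator.
Context {R : realType}.

Definition next_pow2 (k : R) : nat := (2 ^ up_log 2 `|Num.ceil k|%N)%N.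

Definition haar_kernel_pow2 (m : nat) (x y : R) : R :=
  m%:R * \sum_(1 <= j < m.+1)
    \1_(`](j.-1)%:R / m%:R, j%:R / m%:R]%classic) x *
    \1_(`](j.-1)%:R / m%:R, j%:R / m%:R]%classic) y.

(* Truncation levels are arbitrary reals, rounded up to a power of two;
   levels that are already powers of two are unchanged. *)
Definition haar_kernel (k : R) : R -> R -> R := haar_kernel_pow2 (next_pow2 k).

Definition ustat3 (n : nat) (xs : 'I_n -> R) (h : R -> R -> R -> R) : R :=
  (n%:R * (n%:R - 1) * (n%:R - 2))^-1 *
  \sum_(i1 < n) \sum_(i2 < n | i2 != i1)
    \sum_(i3 < n | (i3 != i1) && (i3 != i2)) h (xs i1) (xs i2) (xs i3).

Definition phi_hat (k1 k2 k3 : R) (n : nat) (xs : 'I_n -> R) : R :=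
  let mu := @lebesgue_measure R in
  let K1 := haar_kernel k1 in
  let K2 := haar_kernel k2 in
  let K3 := haar_kernel k3 in
  ustat3 xs (fun y1 y2 y3 =>
    \int[mu]_(x in `[0, 1]) (K1 x y1 * K1 x y2 * K1 x y3)) +
  3 * ustat3 xs (fun y1 y2 y3 =>
    \int[mu]_(x in `[0, 1]) (K1 x y1 * (K3 x y2 - K1 x y2) * K1 x y3)) +
  3 * ustat3 xs (fun y1 y2 y3 =>
    \int[mu]_(x in `[0, 1])
      (K1 x y1 * (K3 x y2 - K1 x y2) * (K3 x y3 - K1 x y3))) +
  3 * ustat3 xs (fun y1 y2 y3 =>
    \int[mu]_(x in `[0, 1])
      ((K2 x y1 - K1 x y1) * (K2 x y2 - K1 x y2) * (K3 x y3 - K2 x y3))) +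
  ustat3 xs (fun y1 y2 y3 =>
    \int[mu]_(x in `[0, 1])
      ((K2 x y1 - K1 x y1) * (K2 x y2 - K1 x y2) * (K2 x y3 - K1 x y3))).

End Estimator.

(* Main.v *)
(** The estimator phi_hat is a single third order U-statistic, whose kernel H
    combines five integrals over x of products of three projection kernels or
    differences of two of them.  With M the sup norm of f, |H| <= C n k3,
    integrating |H| over one variable with respect to f gives at most C M k3,
    and over two variables at most C M^2.  These three bounds are all that is
    needed from the Haar basis: neither orthogonality nor nestedness of the
    projections plays a role.

    Expand the 2m-th moment of the centred sum over 2m-tuples of triples of
    indices.  A tuple in which some triple is disjoint from all the others
    contributes zero, by independence.  Otherwise the graph "share an index" on
    the 2m triples has no isolated vertex, hence has a dominating set of at most
    m triples (Ore).  Summing first over the dominating set and then over the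
    remaining triples, each of which must meet the dominating ones, every triple
    of the first kind costs a factor n k3 mu, with mu of order n^2 / k3, and
    every other one a factor n k3, up to constants.  Hence the 2m-th moment of
    the sum is at most C (n k3)^(2m) (n^2 / k3)^m; division by n^(6m) gives
    (k3 / n^2)^m.  A real exponent q is handled through
    t^q <= a^q (1 + (t / a)^m) with a = k3 / n^2 and m >= q.

    Everything depends on X_i only through the bins, at the three levels, that
    contain it, so that all expectations become finite sums over a product
    weight. *)
Require Import Defs.
From HB Require Import structures.
From mathcomp Require Import all_boot all_order all_algebra.
From mathcomp Require Import ring lra.

Set Implicit Arguments.
Unset Strict Implicit.
Unset Printing Implicit Defensive.

Import Order.TTheory GRing.Theory Num.Theory.
Local Open Scope ring_scope.

(** * Dominating sets of graphs without isolated vertices *)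

(** The complement of a minimal dominating set [B] also dominates: if some [r] in [B] had no
    neighbour outside [B], then [B] without [r] would still dominate. The smaller of the two sets
    has at most half of the vertices. *)
Lemma dominating_half (T : finType) (e : rel T) :
  symmetric e -> (forall r, exists2 t, t != r & e r t) ->
  exists B : {set T}, (2 * #|B| <= #|T|)%N /\
    forall r, r \notin B -> exists2 b, b \in B & e r b.
Proof.
move=> e_sym e_ex.
pose dom (B : {set T}) := [forall r, (r \notin B) ==> [exists b in B, e r b]].
have domT : dom setT by apply/forallP => r; rewrite inE.
have [B /minsetP [domB minB] _] := minset_exists domT.
have domC : dom (~: B).
  apply/forallP => r; rewrite inE negbK; apply/implyP => rB.
  apply: contraT => /existsPn nr.
  have nrB t : t \notin B -> ~~ e r t.
    by move=> tB; have := nr t; rewrite inE tB.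
  (* The neighbour [u] of [r] must lie in [B], and a vertex outside [B] keeps its neighbour in [B],
     which cannot be [r]. *)
  have domBr : dom (B :\ r).
    apply/forallP => t; apply/implyP; rewrite !inE negb_and negbK => /orP[/eqP ->|tB].
      have [u ur eru] := e_ex r.
      apply/existsP; exists u; rewrite !inE ur eru andbT /=.
      by apply: contraLR eru => /nrB.
    have /existsP[b /andP[bB etb]] := implyP (forallP domB t) tB.
    apply/existsP; exists b; rewrite !inE bB etb !andbT.
    apply/eqP => br; move: (nrB t tB); rewrite e_sym -br etb //.
  by have := minB _ domBr (subD1set _ _) => Br; move: rB; rewrite -Br !inE eqxx.
have H (C : {set T}) : dom C -> forall r, r \notin C -> exists2 b, b \in C & e r b.
  move=> domCC r rC; have /existsP[b /andP[]] := implyP (forallP domCC r) rC.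
  by exists b.
have [le_BC|lt_CB] := leqP #|B| #|~: B|.
  exists B; split; last exact: H.
  by rewrite -(cardsC B) mul2n -addnn leq_add2l.
exists (~: B); split; last exact: H.
by rewrite -(cardsC B) mul2n -addnn leq_add2r ltnW.
Qed.

(** * Sums over lists of fixed length *)

Section IteratedSums.
Context {R : realFieldType} {I : finType}.
Implicit Types F : seq I -> R.

(** The sum runs over lists rather than tuples, so that the head splits off by computation and a
    list can be cut along a mask. *)
Fixpoint msum (j : nat) F : R :=
  if j is j'.+1 then \sum_b msum j' (fun s => F (b :: s)) else F [::].

Lemma ler_msum j F F' :
  (forall s, size s = j -> F s <= F' s) -> msum j F <= msum j F'.
Proof.
elim: j F F' => [|j IH] F F' FF' /=; first exact: FF'.
by apply: ler_sum => b _; apply: IH => s sj; apply: FF'; rewrite /= sj.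
Qed.

Lemma eq_msum j F F' :
  (forall s, size s = j -> F s = F' s) -> msum j F = msum j F'.
Proof.
by move=> FF'; apply/eqP; rewrite eq_le; apply/andP; split; apply: ler_msum => s /FF' ->.
Qed.

Lemma msum_sum j (K : finType) (P : pred K) (F : K -> seq I -> R) :
  msum j (fun s => \sum_(k | P k) F k s) = \sum_(k | P k) msum j (F k).
Proof.
elim: j F => [//|j IH] F /=; rewrite exchange_big; apply: eq_bigr => b _.
exact: IH.
Qed.

Lemma msumZ j a F : msum j (fun s => a * F s) = a * msum j F.
Proof.
elim: j F => [//|j IH] F /=; rewrite mulr_sumr; apply: eq_bigr => b _.
exact: IH.
Qed.

Lemma expr_msum j (x : I -> R) :
  (\sum_b x b) ^+ j = msum j (fun s => \prod_(b <- s) x b).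
Proof.
elim: j => [|j IH] /=; first by rewrite big_nil.
rewrite exprS IH mulr_suml; apply: eq_bigr => b _.
by rewrite -msumZ; apply: eq_msum => s _; rewrite big_cons.
Qed.

(** A list as long as [m] amounts to its two sublists at the true and at the false positions of [m].
    This separates the dominating positions from the others. *)
Lemma msum_mask (m : bitseq) (F : seq I -> seq I -> R) :
  msum (size m) (fun s => F (mask m s) (mask (map negb m) s)) =
  msum (count id m) (fun s1 => msum (count negb m) (F s1)).
Proof.
elim: m F => [//|[] m IH] F /=.
  by apply: eq_bigr => b _; rewrite (IH (fun s1 => F (b :: s1))).
transitivity (msum (count id m) (fun s1 => \sum_b
  msum (count negb m) (fun s2 => F s1 (b :: s2)))); last by [].
rewrite msum_sum; apply: eq_bigr => b _.
by rewrite (IH (fun s1 s2 => F s1 (b :: s2))).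
Qed.

End IteratedSums.

(** * Moments of triple sums under a product weight *)

Section ProductWeights.
Context {R : realFieldType} {D J : finType} {p : D -> R}.
Context (p_ge0 : forall y, 0 <= p y) (p_sum1 : \sum_y p y = 1).
Local Notation Omega := {ffun J -> D}.
Implicit Types (g Z G : Omega -> R) (A : {set J}) (c : Omega).

Definition expect g : R := \sum_(c : Omega) (\prod_i p (c i)) * g c.

Definition upd c i y : Omega := [ffun j => if j == i then y else c j].

Definition avg i g c : R := \sum_y p y * g (upd c i y).

Definition depends_on A g := forall c c', {in A, c =1 c'} -> g c = g c'.

Lemma eq_expect g g' : g =1 g' -> expect g = expect g'.
Proof. by move=> gg'; apply: eq_bigr => c _; rewrite gg'. Qed.

Lemma ler_expect g g' : (forall c, g c <= g' c) -> expect g <= expect g'.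
Proof.
move=> gg'; apply: ler_sum => c _; apply: ler_wpM2l => //.
by apply: prodr_ge0.
Qed.

Lemma expect_ge0 g : (forall c, 0 <= g c) -> 0 <= expect g.
Proof.
move=> g0; apply: sumr_ge0 => c _; apply: mulr_ge0 => //; exact: prodr_ge0.
Qed.

Lemma ler_norm_expect g : `|expect g| <= expect (fun c => `|g c|).
Proof.
apply: le_trans (ler_norm_sum _ _ _) _; apply: ler_sum => c _.
by rewrite normrM ger0_norm //; apply: prodr_ge0.
Qed.

Lemma expectZ a g : expect (fun c => a * g c) = a * expect g.
Proof. by rewrite /expect mulr_sumr; apply: eq_bigr => c _; rewrite mulrCA. Qed.

Lemma expectD g g' : expect (fun c => g c + g' c) = expect g + expect g'.
Proof. by rewrite /expect -big_split /=; apply: eq_bigr => c _; rewrite mulrDr. Qed.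

Lemma expect_sum (K : finType) (P : pred K) (F : K -> Omega -> R) :
  expect (fun c => \sum_(k | P k) F k c) = \sum_(k | P k) expect (F k).
Proof.
rewrite /expect exchange_big /=; apply: eq_bigr => c _; rewrite mulr_sumr //.
Qed.

Lemma expect_msum (I : finType) j (F : Omega -> seq I -> R) :
  expect (fun c => msum j (F c)) = msum j (fun s => expect (F ^~ s)).
Proof.
elim: j F => [//|j IH] F /=; rewrite expect_sum; apply: eq_bigr => b _.
exact: (IH (fun c s => F c (b :: s))).
Qed.

Lemma upd_upd c i y y' : upd (upd c i y) i y' = upd c i y'.
Proof. by apply/ffunP => j; rewrite !ffunE; case: eqP. Qed.

Lemma upd_id c i : upd c i (c i) = c.
Proof. by apply/ffunP => j; rewrite !ffunE; case: eqP => // ->. Qed.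

Lemma upd_same c i y : upd c i y i = y.
Proof. by rewrite ffunE eqxx. Qed.

Lemma upd_neq c i y j : j != i -> upd c i y j = c j.
Proof. by rewrite ffunE => /negbTE ->. Qed.

Lemma prod_upd c i y :
  (\prod_j p (upd c i y j)) * p (c i) = (\prod_j p (c j)) * p y.
Proof.
rewrite (bigD1 i) //= [in RHS](bigD1 i) //= upd_same.
rewrite (eq_bigr (fun j => p (c j))) => [|j ji]; last by rewrite upd_neq.
by ring.
Qed.

(* The swap of the [i]-th coordinate with an independent copy of it preserves
   the product weight. *)
Lemma expect_avg i g : expect g = expect (avg i g).
Proof.
rewrite /expect /avg.
under [RHS]eq_bigr do rewrite mulr_sumr.
rewrite pair_bigA /=.
pose sw (u : Omega * D) := (upd u.1 i u.2, u.1 i).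
have swK : involutive sw.
  by case=> c y; rewrite /sw /= upd_upd upd_same upd_id.
rewrite (reindex_inj (inv_inj swK)) /=.
under [RHS]eq_bigr do rewrite upd_upd upd_id mulrA prod_upd.
rewrite -(pair_bigA _ (fun c y => (\prod_j p (c j)) * p y * g c)) /=.
apply: eq_bigr => c _; rewrite -mulr_suml -mulr_sumr p_sum1 mulr1 //.
Qed.

Lemma depends_on_upd A g c i y : depends_on A g -> i \notin A -> g (upd c i y) = g c.
Proof.
move=> dg iA; apply: dg => j jA; rewrite upd_neq //.
by apply: contraNneq iA => <-.
Qed.

Lemma depends_onM A A' g g' : depends_on A g -> depends_on A' g' ->
  depends_on (A :|: A') (fun c => g c * g' c).
Proof.
move=> dg dg' c c' cc'; congr (_ * _); [apply: dg|apply: dg'] => i iA;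
by apply: cc'; rewrite inE iA ?orbT.
Qed.

(** Fubini: [Z] does not see coordinate [i], so only [G] is averaged over it. *)
Lemma expect_avgM A i Z G : depends_on A Z -> i \notin A ->
  expect (fun c => Z c * G c) = expect (fun c => Z c * avg i G c).
Proof.
move=> dZ iA; rewrite (expect_avg i); apply: eq_expect => c.
rewrite /avg mulr_sumr; apply: eq_bigr => y _.
by rewrite (depends_on_upd _ _ dZ iA) mulrCA.
Qed.

Lemma expectM_le Z G t : (forall c, 0 <= Z c) -> (forall c, G c <= t) ->
  expect (fun c => Z c * G c) <= t * expect Z.
Proof.
move=> Z0 Gt; rewrite -expectZ; apply: ler_expect => c.
by rewrite mulrC; apply: ler_wpM2r.
Qed.

Lemma expect_cst a : expect (fun=> a) = a.
Proof.
rewrite (eq_expect (g' := fun=> a * 1)) => [|c]; last by rewrite mulr1.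
rewrite expectZ /expect -(eq_bigr _ (fun c _ => esym (mulr1 _))).
by rewrite -(bigA_distr_bigA (fun _ y => p y)) big1 ?mulr1.
Qed.

(** * Moments of sums of centred terms that depend on few coordinates *)

Section Moments.
(** [K] is the price of summing over the terms that meet a given set of coordinates, [K * mu] that
    of summing over all terms; [3 * j] coordinates are the most that [j] terms can use. Centring is
    stated against every [Z] that ignores [supp b], which includes independence. *)
Context {I : finType} (supp : I -> {set J}) (x G : I -> Omega -> R).
Context (K mu : R) (j : nat).
Context (supp_le3 : forall b, (#|supp b| <= 3)%N).
Context (dep_x : forall b, depends_on (supp b) (x b)).
Context (dep_G : forall b, depends_on (supp b) (G b)).
Context (le_xG : forall b c, `|x b c| <= G b c).
Context (centered_x : forall b Z, depends_on (~: supp b) Z ->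
  expect (fun c => x b c * Z c) = 0).
Context (K_ge0 : 0 <= K) (mu_ge1 : 1 <= mu).
Context (sum_touching : forall A Z, (#|A| <= 3 * j)%N -> depends_on A Z ->
  (forall c, 0 <= Z c) ->
  \sum_(b | ~~ [disjoint supp b & A]) expect (fun c => Z c * G b c)
    <= K * expect Z).
Context (sum_all : forall A Z, (#|A| <= 3 * j)%N -> depends_on A Z ->
  (forall c, 0 <= Z c) ->
  \sum_b expect (fun c => Z c * G b c) <= K * mu * expect Z).

Let G_ge0 b c : 0 <= G b c.
Proof. exact: le_trans (le_xG b c). Qed.

Let ext_card A b k : (#|A| + 3 * k.+1 <= 3 * j)%N ->
  (#|A :|: supp b| + 3 * k <= 3 * j)%N.
Proof.
move=> h; apply: leq_trans h; rewrite mulnS addnA leq_add2r.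
apply: leq_trans (leq_add (leqnn _) (supp_le3 b)).
by rewrite cardsU leq_subr.
Qed.

Let all_touch A s := all (fun b => ~~ [disjoint supp b & A]) s.

Let all_touchS A A' s : A \subset A' -> all_touch A s -> all_touch A' s.
Proof.
move=> AA'; apply: sub_all => b; apply: contraNN => dA'.
by rewrite disjoint_sym (disjointWl AA') // disjoint_sym.
Qed.

Let prods s c := \prod_(b <- s) G b c.

Let prods_ge0 s c : 0 <= prods s c.
Proof. by rewrite /prods prodr_ge0. Qed.

(** Induction on [l]: the head [b] meets [A] and costs a factor [K]; its envelope is absorbed into
    [Z] and its support into [A]. *)
Let msum_touching l A Z : (#|A| + 3 * l <= 3 * j)%N -> depends_on A Z ->
  (forall c, 0 <= Z c) ->
  msum l (fun s => (all_touch A s)%:R * expect (fun c => Z c * prods s c))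
    <= K ^+ l * expect Z.
Proof.
elim: l A Z => [|l IH] A Z Aj dZ Z0 /=.
  rewrite !mul1r (eq_expect (g' := Z)) // => c.
  by rewrite /prods big_nil mulr1.
rewrite (bigID (fun b => ~~ [disjoint supp b & A])) /=.
rewrite [X in _ + X]big1 ?addr0 => [|b /negbTE nb]; last first.
  rewrite (@eq_msum _ _ _ _ (fun=> 0 * 0)) => [|s _]; last by rewrite nb !mul0r.
  by rewrite msumZ mul0r.
rewrite exprSr -mulrA.
have Aj' : (#|A| <= 3 * j)%N by apply: leq_trans Aj; apply: leq_addr.
apply: le_trans (ler_wpM2l (exprn_ge0 _ K_ge0) (sum_touching Aj' dZ Z0)).
rewrite mulr_sumr; apply: ler_sum => b tb.
apply: le_trans (IH (A :|: supp b) (fun c => Z c * G b c) _ _ _).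
- apply: ler_msum => s _; rewrite tb /=.
  rewrite (eq_expect (g' := fun c => Z c * G b c * prods s c)); last first.
    by move=> c; rewrite /prods big_cons mulrA.
  apply: ler_wpM2r.
    by apply: expect_ge0 => c; rewrite !mulr_ge0.
  rewrite ler_nat; have := @all_touchS A (A :|: supp b) s (subsetUl _ _).
  by case: (all_touch A s) => // /(_ isT) ->.
- exact: ext_card.
- exact: depends_onM.
- by move=> c; rewrite mulr_ge0.
Qed.

Let supps s := \bigcup_(b <- s) supp b.

(** The first [k] terms are free and cost [K * mu] each, while the set to be met grows by their
    supports; [msum_touching] handles the last [l]. *)
Let msum_dominated k l A Z : (#|A| + 3 * (k + l) <= 3 * j)%N ->
  depends_on A Z -> (forall c, 0 <= Z c) ->
  msum k (fun s1 => msum l (fun s2 => (all_touch (A :|: supps s1) s2)%:R *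
      expect (fun c => Z c * (prods s1 c * prods s2 c))))
    <= (K * mu) ^+ k * K ^+ l * expect Z.
Proof.
elim: k A Z => [|k IH] A Z Aj dZ Z0 /=.
  rewrite expr0 mul1r; apply: le_trans (msum_touching Aj dZ Z0).
  apply: ler_msum => s _; rewrite /supps big_nil setU0.
  rewrite le_eqVlt; apply/orP; left; apply/eqP; congr (_ * _).
  by apply: eq_expect => c; rewrite /prods big_nil mul1r.
have Kmu0 : 0 <= K * mu by rewrite mulr_ge0 // (le_trans ler01).
have Aj' : (#|A| <= 3 * j)%N by apply: leq_trans Aj; apply: leq_addr.
have h0 : 0 <= (K * mu) ^+ k * K ^+ l by rewrite mulr_ge0 // exprn_ge0.
have -> : (K * mu) ^+ k.+1 * K ^+ l * expect Z =
    (K * mu) ^+ k * K ^+ l * (K * mu * expect Z) by rewrite exprSr; ring.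
apply: le_trans (ler_wpM2l h0 (sum_all Aj' dZ Z0)).
rewrite mulr_sumr; apply: ler_sum => b _.
apply: le_trans (IH (A :|: supp b) (fun c => Z c * G b c) _ _ _).
- apply: ler_msum => s1 _; apply: ler_msum => s2 _.
  rewrite /supps big_cons setUA.
  rewrite le_eqVlt; apply/orP; left; apply/eqP; congr (_ * _).
  by apply: eq_expect => c; rewrite /prods big_cons !mulrA.
- by apply: ext_card; rewrite -addSn.
- exact: depends_onM.
- by move=> c; rewrite mulr_ge0.
Qed.

(** The product of the other terms ignores the support of the isolated one, so centring applies. *)
Let isolated_vanish (t : j.-tuple I) r :
  (forall u, u != r -> [disjoint supp (tnth t r) & supp (tnth t u)]) ->
  expect (fun c => \prod_(b <- t) x b c) = 0.
Proof.
move=> iso.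
pose Z c := \prod_(u < j | u != r) x (tnth t u) c.
rewrite (eq_expect (g' := fun c => x (tnth t r) c * Z c)); last first.
  by move=> c; rewrite big_tuple (bigD1 r).
apply: centered_x => c c' cc'; apply: eq_bigr => u /iso du; apply: dep_x => i iu.
by apply: cc'; rewrite inE (disjointFl du).
Qed.

(** In a list without isolated terms, a dominating set [B] of at most [m] positions is priced
    [K * mu] per term, the other positions [K]. As [mu >= 1], each [B] yields at most
    [K ^+ j * mu ^+ m], and the [2 * m] positions have [4 ^+ m] subsets. *)
Lemma moment_le m : j = (2 * m)%N ->
  expect (fun c => (\sum_b x b c) ^+ j) <= 4 ^+ m * K ^+ j * mu ^+ m.
Proof.
move=> jm.
rewrite (eq_expect (g' := fun c => msum j (fun s => \prod_(b <- s) x b c)));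
  last by move=> c; rewrite expr_msum.
rewrite expect_msum.
pose mk (B : {set 'I_j}) := [seq i \in B | i <- enum 'I_j].
have size_mk B : size (mk B) = j by rewrite size_map size_enum_ord.
have cnt_mk B : count id (mk B) = #|B|.
  by rewrite count_map cardE -size_filter enumT; congr size; apply: eq_filter.
have cntN_mk B : count negb (mk B) = (j - #|B|)%N.
  have := count_predC id (mk B); rewrite size_mk cnt_mk => cntC.
  by rewrite -[X in (X - _)%N]cntC addKn; apply: eq_count.
(* The bound for a list carrying [s1] at the positions of [B] and [s2] elsewhere; it is zero unless
   every term of [s2] meets some term of [s1]. *)
pose T s1 s2 := (all_touch (set0 :|: supps s1) s2)%:R *
  expect (fun c => 1 * (prods s1 c * prods s2 c)).
have T_ge0 s1 s2 : 0 <= T s1 s2.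
  by rewrite mulr_ge0 // expect_ge0 // => c; rewrite !mulr_ge0.
(* The right [B] depends on the list; summing over all candidates removes this dependence, the
   summands being nonnegative. *)
apply: (@le_trans _ _ (msum j (fun s => \sum_(B : {set 'I_j} | (2 * #|B| <= j)%N)
    T (mask (mk B) s) (mask (map negb (mk B)) s)))).
  apply: ler_msum => s /eqP sj.
  rewrite (_ : s = tval (Tuple sj)) //; move: (Tuple sj) => {s sj} t.
  pose e r u := ~~ [disjoint supp (tnth t r) & supp (tnth t u)].
  have e_sym : symmetric e by move=> r u; rewrite /e disjoint_sym.
  case: (boolP [exists r, [forall u, (u != r) ==> ~~ e r u]]).
    move=> /existsP[r /forallP iso]; rewrite (isolated_vanish (r := r)).
      by apply: sumr_ge0 => B _.
    by move=> u ur; have := implyP (iso u) ur; rewrite negbK.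
  rewrite negb_exists => /forallP noiso.
  have e_ex r : exists2 u, u != r & e r u.
    have := noiso r; rewrite negb_forall => /existsP[u].
    by rewrite negb_imply negbK => /andP[]; exists u.
  have [B [cardB domB]] := dominating_half e_sym e_ex.
  rewrite card_ord in cardB.
  rewrite (bigD1 B) //= -[leLHS]addr0.
  apply: lerD; last by apply: sumr_ge0.
  have maskE (P : pred 'I_j) :
      mask [seq P i | i <- enum 'I_j] t = [seq tnth t i | i <- enum 'I_j & P i].
    by rewrite -[X in mask _ X](map_tnth_enum t) -map_mask filter_mask.
  rewrite /T /mk -map_comp !maskE.
  have -> : all_touch (set0 :|: supps [seq tnth t i | i <- enum 'I_j & i \in B])
     [seq tnth t i | i <- enum 'I_j & (negb \o (fun i => i \in B)) i].
    apply/allP => v /mapP[r]; rewrite mem_filter /= => /andP[rB _] ->.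
    have [b bB] := domB r rB; apply: contraNN; rewrite set0U => dr.
    apply: disjointWr dr; rewrite /supps bigcup_seq; apply: (bigcup_sup (tnth t b)).
    by apply: map_f; rewrite mem_filter bB mem_enum.
  rewrite mul1r; apply: le_trans (ler_norm _) _; apply: le_trans (ler_norm_expect _) _.
  apply: ler_expect => c; rewrite mul1r normr_prod /prods !big_map !big_filter.
  rewrite big_tuple !big_enum_cond /=.
  rewrite (bigID (mem B)) /=.
  by apply: ler_pM => //; rewrite ?prodr_ge0 //; apply: ler_prod => b _; rewrite normr_ge0 le_xG.
rewrite msum_sum.
apply: (@le_trans _ _ (\sum_(B : {set 'I_j} | (2 * #|B| <= j)%N) K ^+ j * mu ^+ m)).
  apply: ler_sum => B hB.
  have Bj : (#|B| <= j)%N by apply: leq_trans hB; rewrite leq_pmull.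
  rewrite -(size_mk B) msum_mask cnt_mk cntN_mk.
  apply: le_trans (msum_dominated (A := set0) (Z := fun=> 1) _ _ _) _ => //.
  - by rewrite cards0 add0n subnKC.
  rewrite expect_cst mulr1 exprMn mulrAC -exprD subnKC //.
  rewrite size_mk ler_wpM2l ?exprn_ge0 // ler_weXn2l //.
  by rewrite -(leq_pmul2l (isT : (0 < 2)%N)) -jm.
rewrite big_mkcond /=.
apply: (@le_trans _ _ (\sum_(B : {set 'I_j}) K ^+ j * mu ^+ m)).
  apply: ler_sum => B _; case: ifP => // _.
  by rewrite mulr_ge0 // exprn_ge0 // (le_trans ler01).
rewrite sumr_const -cardsT -powersetT card_powerset cardsT card_ord jm.
rewrite -[_ *+ 2 ^ _]mulr_natl natrX (exprM 2) mulrA.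
by rewrite (_ : 2 ^+ 2 = 4 :> R) //; ring.
Qed.

End Moments.

(** * Sums over triples of distinct indices *)

Section TripleSums.
Implicit Types (h : D -> D -> D -> R) (b : J * J * J).

Definition lift3 h b c : R := h (c b.1.1) (c b.1.2) (c b.2).

Definition distinct3 b := [&& b.1.2 != b.1.1, b.2 != b.1.1 & b.2 != b.1.2].

Definition mean3 h : R := \sum_x p x * \sum_y p y * \sum_z p z * h x y z.

(** The kernel of the estimator is not symmetric, so each bound is required for every choice of the
    variables. *)
Definition marginals_le h (S T1 T2 : R) : Prop :=
  [/\ forall x y z, `|h x y z| <= S,
     [/\ forall y z, \sum_x p x * `|h x y z| <= T1,
        forall x z, \sum_y p y * `|h x y z| <= T1 &
        forall x y, \sum_z p z * `|h x y z| <= T1] &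
     [/\ forall z, \sum_x p x * \sum_y p y * `|h x y z| <= T2,
        forall y, \sum_x p x * \sum_z p z * `|h x y z| <= T2 &
        forall x, \sum_y p y * \sum_z p z * `|h x y z| <= T2]].

Lemma marginals_leD h h' S T1 T2 S' T1' T2' :
  marginals_le h S T1 T2 -> marginals_le h' S' T1' T2' ->
  marginals_le (fun x y z => h x y z + h' x y z) (S + S') (T1 + T1') (T2 + T2').
Proof.
have tri1 (u v : D -> R) t t' : \sum_x p x * `|u x| <= t -> \sum_x p x * `|v x| <= t' ->
    \sum_x p x * `|u x + v x| <= t + t'.
  move=> ut vt'; apply: le_trans (lerD ut vt'); rewrite -big_split /=.
  by apply: ler_sum => x _; rewrite -mulrDr ler_wpM2l // ler_normD.
have tri2 (u v : D -> D -> R) t t' : \sum_x p x * \sum_y p y * `|u x y| <= t ->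
    \sum_x p x * \sum_y p y * `|v x y| <= t' ->
    \sum_x p x * \sum_y p y * `|u x y + v x y| <= t + t'.
  move=> ut vt'; apply: le_trans (lerD ut vt'); rewrite -big_split /=.
  by apply: ler_sum => x _; rewrite -mulrDr ler_wpM2l //; apply: tri1.
case=> h0 [h1 h2 h3] [h4 h5 h6] [k0 [k1 k2 k3] [k4 k5 k6]].
split; first by move=> x y z; apply: le_trans (ler_normD _ _) _; apply: lerD.
- by split=> *; apply: tri1.
- by split=> *; apply: tri2.
Qed.

Lemma marginals_leZ a h S T1 T2 :
  marginals_le h S T1 T2 ->
  marginals_le (fun x y z => a * h x y z) (`|a| * S) (`|a| * T1) (`|a| * T2).
Proof.
have sc1 (u : D -> R) : \sum_x p x * `|a * u x| = `|a| * \sum_x p x * `|u x|.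
  by rewrite mulr_sumr; apply: eq_bigr => x _; rewrite normrM mulrCA.
have sc2 (u : D -> D -> R) : \sum_x p x * \sum_y p y * `|a * u x y|
    = `|a| * \sum_x p x * \sum_y p y * `|u x y|.
  by rewrite mulr_sumr; apply: eq_bigr => x _; rewrite sc1 mulrCA.
case=> h0 [h1 h2 h3] [h4 h5 h6].
split; first by move=> x y z; rewrite normrM ler_wpM2l.
- by split=> *; rewrite sc1 ler_wpM2l.
- by split=> *; rewrite sc2 ler_wpM2l.
Qed.

Lemma marginals_le_mono h S T1 T2 S' T1' T2' :
  S <= S' -> T1 <= T1' -> T2 <= T2' ->
  marginals_le h S T1 T2 -> marginals_le h S' T1' T2'.
Proof.
move=> SS' T11 T22 [h0 [h1 h2 h3] [h4 h5 h6]].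
split; first by move=> *; apply: le_trans SS'.
- by split=> *; apply: le_trans T11.
- by split=> *; apply: le_trans T22.
Qed.

Let avg_le_expect A i Z G t : depends_on A Z -> (forall c, 0 <= Z c) ->
  i \notin A -> (forall c, avg i G c <= t) ->
  expect (fun c => Z c * G c) <= t * expect Z.
Proof. by move=> dZ Z0 iA Gt; rewrite (expect_avgM _ dZ iA); apply: expectM_le. Qed.

Let avg2_le_expect A i j Z G t : depends_on A Z -> (forall c, 0 <= Z c) ->
  i \notin A -> j \notin A -> (forall c, avg i (avg j G) c <= t) ->
  expect (fun c => Z c * G c) <= t * expect Z.
Proof.
move=> dZ Z0 iA jA Gt; rewrite (expect_avgM _ dZ jA).
exact: (avg_le_expect dZ Z0 iA Gt).
Qed.

Let supp3 b : {set J} := [set b.1.1; b.1.2; b.2].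

Let depends_on_lift3 h b : depends_on (supp3 b) (lift3 h b).
Proof. by move=> c c' cc'; rewrite /lift3 !cc' // !inE eqxx ?orbT. Qed.

(** The three indices are distinct and outside [A], so their coordinates are averaged out in turn
    while [Z] stays fixed. *)
Lemma expect_lift3 h b A Z : distinct3 b -> depends_on A Z ->
  [disjoint supp3 b & A] ->
  expect (fun c => Z c * lift3 h b c) = mean3 h * expect Z.
Proof.
case: b => -[i j] k /and3P[/= ji ki kj] dZ dA.
have [iA jA kA] : [/\ i \notin A, j \notin A & k \notin A].
  by split; apply/negP => uA; move: (disjointFl dA uA); rewrite !inE eqxx ?orbT.
rewrite (expect_avgM _ dZ kA) (expect_avgM _ dZ jA) (expect_avgM _ dZ iA).
rewrite -expectZ; apply: eq_expect => c; rewrite mulrC; congr (_ * _).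
apply: eq_bigr => x _; congr (_ * _); apply: eq_bigr => y _; congr (_ * _).
apply: eq_bigr => z _; rewrite /lift3 /=.
by rewrite !(upd_same, upd_neq) // eq_sym.
Qed.

Lemma expect_lift3_mean h b : distinct3 b -> expect (lift3 h b) = mean3 h.
Proof.
move=> db; rewrite (eq_expect (g' := fun c => 1 * lift3 h b c)) => [|c]; last by rewrite mul1r.
rewrite (expect_lift3 _ db (A := set0)) ?expect_cst ?mulr1 //.
by rewrite disjoint_sym disjoints_subset sub0set.
Qed.

(** Up to the constant [L], integrating out one variable gains a factor [N] over the sup bound [S],
    integrating out two gains [N ^+ 2], and the means of the absolute kernel over all [N ^+ 3]
    triples add up to at most [mu * S]. *)
Context (h : D -> D -> D -> R) (S T1 T2 L mu : R) (m : nat).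
Let N : R := #|J|%:R.
Context (J_gt0 : (0 < #|J|)%N) (h_le : marginals_le h S T1 T2).
Context (L_ge1 : 1 <= L) (mu_ge1 : 1 <= mu) (S_ge0 : 0 <= S).
Context (T1_le : N * T1 <= L * S) (T2_le : N ^+ 2 * T2 <= L * S).
Context (T2_le_mu : N ^+ 3 * T2 <= L * mu * S).

Let habs x y z := `|h x y z|.

(* Summed over all triples, the product of the three weights is (#|A| + 1)^3 at
   most, whichever of the three indices lie in [A]. *)
Let weight (A : {set J}) i : R := if i \in A then 1 else N^-1.

Let N_gt0 : 0 < N. Proof. by rewrite ltr0n. Qed.
Let L_ge0 : 0 <= L. Proof. exact: le_trans ler01 L_ge1. Qed.

(** The indices outside [A] are integrated out. There are none, one or two of them, bounded through
    [S], [T1] or [T2], and each brings a factor [N^-1]. *)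
Let expect_habs_le b A Z : distinct3 b -> depends_on A Z -> (forall c, 0 <= Z c) ->
  ~~ [disjoint supp3 b & A] ->
  expect (fun c => Z c * lift3 habs b c) <=
    L * S * (weight A b.1.1 * weight A b.1.2 * weight A b.2) * expect Z.
Proof.
have [h0 [h1 h2 h3] [h4 h5 h6]] := h_le.
case: b => -[i j] k /and3P[/= ji ki kj] dZ Z0.
have [ij ik jk] : [/\ i != j, i != k & j != k] by split; rewrite eq_sym.
have S_le : S <= L * S by rewrite ler_peMl.
have T1_le' : T1 <= L * S * N^-1 by rewrite ler_pdivlMr // mulrC.
have T2_le' : T2 <= L * S * (N^-1 * N^-1).
  by rewrite -invfM ler_pdivlMr ?mulr_gt0 // mulrC.
have EZ0 := expect_ge0 Z0.
rewrite /weight /=.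
case: ifPn => iA; case: ifPn => jA; case: ifPn => kA; rewrite ?(mulr1, mul1r) => tA.
- by apply: le_trans (expectM_le Z0 _) (ler_wpM2r EZ0 S_le) => c; apply: h0.
- apply: le_trans (avg_le_expect (t := T1) dZ Z0 kA _) (ler_wpM2r EZ0 T1_le') => c.
  rewrite /avg /lift3 /=; under eq_bigr do rewrite upd_same !upd_neq //.
  exact: h3.
- apply: le_trans (avg_le_expect (t := T1) dZ Z0 jA _) (ler_wpM2r EZ0 T1_le') => c.
  rewrite /avg /lift3 /=; under eq_bigr do rewrite upd_same !upd_neq //.
  exact: h2.
- apply: le_trans (avg2_le_expect (t := T2) dZ Z0 jA kA _) (ler_wpM2r EZ0 T2_le') => c.
  rewrite /avg /lift3 /=.
  under eq_bigr do under eq_bigr do rewrite !(upd_same, upd_neq) //.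
  exact: h6.
- apply: le_trans (avg_le_expect (t := T1) dZ Z0 iA _) (ler_wpM2r EZ0 T1_le') => c.
  rewrite /avg /lift3 /=; under eq_bigr do rewrite upd_same !upd_neq //.
  exact: h1.
- apply: le_trans (avg2_le_expect (t := T2) dZ Z0 iA kA _) (ler_wpM2r EZ0 T2_le') => c.
  rewrite /avg /lift3 /=.
  under eq_bigr do under eq_bigr do rewrite !(upd_same, upd_neq) //.
  exact: h5.
- apply: le_trans (avg2_le_expect (t := T2) dZ Z0 iA jA _) (ler_wpM2r EZ0 T2_le') => c.
  rewrite /avg /lift3 /=.
  under eq_bigr do under eq_bigr do rewrite !(upd_same, upd_neq) //.
  exact: h4.
(* Three indices outside [A] contradict that the triple meets [A]. *)
- case/negP: tA; rewrite disjoint_subset; apply/subsetP => u.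
  by rewrite !inE => /orP[/orP[]|] /eqP->.
Qed.

Let mean_habs_ge0 : 0 <= mean3 habs.
Proof.
apply: sumr_ge0 => x _; apply: mulr_ge0 => //; apply: sumr_ge0 => y _.
apply: mulr_ge0 => //; apply: sumr_ge0 => z _; apply: mulr_ge0 => //.
exact: normr_ge0.
Qed.

Let mean_habs_le : mean3 habs <= T2.
Proof.
have [_ _ [_ _ h6]] := h_le.
rewrite -[leRHS]mul1r -p_sum1 mulr_suml; apply: ler_sum => x _.
apply: ler_wpM2l => //; exact: h6.
Qed.

(** The added mean makes this dominate the centred kernel; the indicator lets sums run over all
    triples. *)
Let env b c : R := (distinct3 b)%:R * (lift3 habs b c + mean3 habs).

(** The mean is at most [T2], of order [N^-1 * N^-1], which is below the product of the weights: one
    of them is 1 and the others are at least [N^-1]. *)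
Let expect_env_le b A Z : depends_on A Z -> (forall c, 0 <= Z c) ->
  ~~ [disjoint supp3 b & A] ->
  expect (fun c => Z c * env b c) <=
    2 * (L * S) * (weight A b.1.1 * weight A b.1.2 * weight A b.2) * expect Z.
Proof.
move=> dZ Z0 tA; have EZ0 := expect_ge0 Z0.
have w0 i : 0 <= weight A i by rewrite /weight; case: ifP; rewrite ?invr_ge0 // ltW.
have LS0 : 0 <= L * S by rewrite mulr_ge0 // (le_trans ler01).
have [db|ndb] := boolP (distinct3 b); last first.
  rewrite (eq_expect (g' := fun=> 0 * 0)) ?expectZ ?mul0r ?mulr_ge0 ?w0 //.
  by move=> c; rewrite /env (negbTE ndb) mulr0n !(mul0r, mulr0).
rewrite (eq_expect (g' := fun c => Z c * lift3 habs b c + mean3 habs * Z c)); last first.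
  by move=> c; rewrite /env db mul1r mulrDr [mean3 _ * _]mulrC.
rewrite expectD expectZ.
set W := weight A b.1.1 * _ * _.
suff T2W : T2 <= L * S * W.
  have := lerD (expect_habs_le db dZ Z0 tA)
    (ler_wpM2r EZ0 (le_trans mean_habs_le T2W)).
  by rewrite -/W -mulrDl -mulrDr; congr (_ <= _); ring.
have N2 : T2 <= L * S * (N^-1 * N^-1).
  by rewrite -invfM ler_pdivlMr ?mulr_gt0 // mulrC.
apply: le_trans N2 _; apply: ler_wpM2l => //; rewrite /W.
have wN i : N^-1 <= weight A i.
  by rewrite /weight; case: ifP => // _; rewrite invf_le1 // ler1n.
have w1 i : i \in A -> weight A i = 1 by rewrite /weight => ->.
have iN0 : 0 <= N^-1 by rewrite invr_ge0 ltW.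
move: tA; rewrite -setI_eq0 => /set0Pn[u]; rewrite !inE => /andP[/orP[/orP[]|] /eqP -> uA].
- by rewrite (w1 _ uA) mul1r; apply: ler_pM.
- by rewrite (w1 _ uA) mulr1; apply: ler_pM.
- by rewrite (w1 _ uA) mulr1; apply: ler_pM.
Qed.

Let sum_weight A : (#|A| <= 6 * m)%N ->
  \sum_b weight A b.1.1 * weight A b.1.2 * weight A b.2 <= ((6 * m).+1%:R) ^+ 3.
Proof.
move=> cA.
rewrite -(pair_bigA _ (fun ij k => weight A ij.1 * weight A ij.2 * weight A k)) /=.
under eq_bigr do rewrite -mulr_sumr.
rewrite -mulr_suml -(pair_bigA _ (fun i j => weight A i * weight A j)) /=.
under eq_bigr do rewrite -mulr_sumr.
rewrite -mulr_suml -expr2 -exprSr.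
have w0 i : 0 <= weight A i by rewrite /weight; case: ifP; rewrite ?invr_ge0 // ltW.
rewrite lerXn2r ?nnegrE ?sumr_ge0 //.
apply: (@le_trans _ _ (\sum_i ((i \in A)%:R + N^-1))).
  apply: ler_sum => i _; rewrite /weight; case: ifP => _; last by rewrite add0r.
  by rewrite lerDl invr_ge0 ltW.
rewrite big_split /= sumr_const -[_ *+ #|_|]mulr_natr mulVf ?gt_eqF //.
have -> : \sum_i (i \in A)%:R = #|A|%:R :> R.
  by rewrite -sum1_card natr_sum [RHS]big_mkcond; apply: eq_bigr => i _; case: (i \in A).
by rewrite -natr1 lerD2r ler_nat.
Qed.

Let sum_touching_env A Z : (#|A| <= 6 * m)%N -> depends_on A Z ->
  (forall c, 0 <= Z c) ->
  \sum_(b | ~~ [disjoint supp3 b & A]) expect (fun c => Z c * env b c) <=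
    2 * (L * S) * ((6 * m).+1%:R) ^+ 3 * expect Z.
Proof.
move=> cA dZ Z0; have EZ0 := expect_ge0 Z0.
have LS0 : 0 <= 2 * (L * S) by rewrite !mulr_ge0 // (le_trans ler01).
have w0 i : 0 <= weight A i by rewrite /weight; case: ifP; rewrite ?invr_ge0 // ltW.
apply: (@le_trans _ _ (\sum_b
    2 * (L * S) * (weight A b.1.1 * weight A b.1.2 * weight A b.2) * expect Z)).
  rewrite big_mkcond /=; apply: ler_sum => b _; case: ifP => tb.
    exact: expect_env_le.
  by rewrite !mulr_ge0.
rewrite -mulr_suml -mulr_sumr; apply: ler_wpM2r => //; apply: ler_wpM2l => //.
exact: sum_weight.
Qed.

(** Away from [A] the expectation factorizes, and each of the [N ^+ 3] triples contributes at most
    [2 * T2 * expect Z]. *)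
Let sum_disjoint_env A Z : depends_on A Z -> (forall c, 0 <= Z c) ->
  \sum_(b | [disjoint supp3 b & A]) expect (fun c => Z c * env b c) <=
    2 * (L * S) * mu * expect Z.
Proof.
move=> dZ Z0; have EZ0 := expect_ge0 Z0.
apply: (@le_trans _ _ (\sum_(b : J * J * J) 2 * T2 * expect Z)).
  rewrite big_mkcond /=; apply: ler_sum => b _.
  have T2EZ : 0 <= 2 * T2 * expect Z.
    by rewrite !mulr_ge0 // (le_trans mean_habs_ge0).
  case: ifP => // db.
  have [d3|nd3] := boolP (distinct3 b); last first.
    rewrite (eq_expect (g' := fun=> 0 * 0)) ?expectZ ?mul0r //.
    by move=> c; rewrite /env (negbTE nd3) mulr0n !(mul0r, mulr0).
  rewrite (eq_expect (g' := fun c => Z c * lift3 habs b c + mean3 habs * Z c)); last first.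
    by move=> c; rewrite /env d3 mul1r mulrDr [mean3 _ * _]mulrC.
  rewrite expectD expectZ (expect_lift3 _ d3 dZ db) -mulrDl ler_wpM2r //.
  by rewrite mulr_natl mulr2n lerD.
rewrite sumr_const !card_prod -[_ *+ (_ * _)]mulr_natl !natrM mulrA; apply: ler_wpM2r => //.
have : 2 * (N ^+ 3 * T2) <= 2 * (L * mu * S) by rewrite ler_wpM2l.
by rewrite /N; congr (_ <= _); ring.
Qed.

(** In the price [K] used for [moment_le], the cube pays for the triples that meet a set of at most
    [6 * m = 3 * (2 * m)] indices, and the final 1 for the disjoint ones. *)
Lemma triple_sum_moment_le :
  expect (fun c => (\sum_(b | distinct3 b) (lift3 h b c - mean3 h)) ^+ (2 * m)) <=
  4 ^+ m * (2 * (L * S) * (((6 * m).+1%:R) ^+ 3 + 1)) ^+ (2 * m) * mu ^+ m.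
Proof.
rewrite (eq_expect (g' := fun c =>
  (\sum_b ((distinct3 b)%:R * (lift3 h b c - mean3 h))) ^+ (2 * m))); last first.
  move=> c; congr (_ ^+ _); rewrite big_mkcond; apply: eq_bigr => b _.
  by case: ifP; rewrite ?mul1r ?mul0r.
apply: (moment_le (supp := supp3) (G := env)) => //.
- move=> b; apply: leq_trans (leq_card_setU _ _) _; rewrite cards1 addn1 ltnS.
  by apply: leq_trans (leq_card_setU _ _) _; rewrite !cards1.
- by move=> b c c' cc'; rewrite (depends_on_lift3 _ cc').
- by move=> b c c' cc'; rewrite /env (depends_on_lift3 _ cc').
- move=> b c; rewrite /env normrM ger0_norm // ler_wpM2l //.
  apply: le_trans (ler_normB _ _) _; rewrite lerD2l.
  apply: le_trans (ler_norm_sum _ _ _) _; apply: ler_sum => x _.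
  rewrite normrM ger0_norm // ler_wpM2l //.
  apply: le_trans (ler_norm_sum _ _ _) _; apply: ler_sum => y _.
  rewrite normrM ger0_norm // ler_wpM2l //.
  apply: le_trans (ler_norm_sum _ _ _) _; apply: ler_sum => z _.
  by rewrite normrM ger0_norm.
- move=> b Z dZ; have [db|ndb] := boolP (distinct3 b); last first.
    rewrite (eq_expect (g' := fun=> 0 * 0)) ?expectZ ?mul0r //.
    by move=> c; rewrite !mul0r.
  rewrite (eq_expect (g' := fun c => Z c * lift3 h b c + (- mean3 h) * Z c)).
    rewrite expectD expectZ (expect_lift3 _ db dZ) ?mulNr ?subrr //.
    by rewrite disjoints_subset setCK.
  by move=> c; rewrite mul1r mulrBl mulNr mulrC.
- by rewrite !mulr_ge0 ?addr_ge0 ?exprn_ge0 // (le_trans ler01).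
- move=> A Z cA dZ Z0.
  have cA' : (#|A| <= 6 * m)%N by apply: leq_trans cA _; rewrite mulnA.
  apply: le_trans (sum_touching_env cA' dZ Z0) _.
  rewrite ler_wpM2r ?expect_ge0 // ler_wpM2l ?lerDl //.
  by rewrite !mulr_ge0 // (le_trans ler01).
- move=> A Z cA dZ Z0.
  have cA' : (#|A| <= 6 * m)%N by apply: leq_trans cA _; rewrite mulnA.
  rewrite (bigID (fun b => ~~ [disjoint supp3 b & A])) /=.
  rewrite [X in _ + X <= _](eq_bigl (fun b => [disjoint supp3 b & A])) => [|b];
    last by rewrite negbK.
  apply: le_trans (lerD (sum_touching_env cA' dZ Z0) (sum_disjoint_env dZ Z0)) _.
  rewrite -mulrDl ler_wpM2r ?expect_ge0 //.
  have LS0 : 0 <= 2 * (L * S) by rewrite !mulr_ge0 // (le_trans ler01).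
  rewrite -mulrDr -mulrA ler_wpM2l // mulrDl mul1r lerD2r ler_peMr //.
  exact: exprn_ge0.
Qed.

End TripleSums.
End ProductWeights.

(** * Marginal bounds for products of kernels *)

Section KernelProducts.
Context {R : realFieldType} {D : finType} (q p : D -> R).
Context (q_ge0 : forall y, 0 <= q y) (p_ge0 : forall y, 0 <= p y).
Implicit Types g : D -> D -> R.

(** Here [d] is the bin of the integration variable, weighted by [q], and [y] that of an
    observation, weighted by [p]. *)
Definition kernel_le g (s cq cp : R) : Prop :=
  [/\ forall d y, `|g d y| <= s, forall y, \sum_d q d * `|g d y| <= cq &
      forall d, \sum_y p y * `|g d y| <= cp].

Definition triple_overlap g1 g2 g3 (x y z : D) : R :=
  \sum_d q d * (g1 d x * g2 d y * g3 d z).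

Lemma kernel_leB g g' s cq cp s' cq' cp' :
  kernel_le g s cq cp -> kernel_le g' s' cq' cp' ->
  kernel_le (fun d y => g d y - g' d y) (s + s') (cq + cq') (cp + cp').
Proof.
have tri (w u v : D -> R) t t' : (forall x, 0 <= w x) ->
    \sum_x w x * `|u x| <= t -> \sum_x w x * `|v x| <= t' ->
    \sum_x w x * `|u x - v x| <= t + t'.
  move=> w0 ut vt'; apply: le_trans (lerD ut vt'); rewrite -big_split /=.
  by apply: ler_sum => x _; rewrite -mulrDr ler_wpM2l // ler_normB.
case=> h0 h1 h2 [k0 k1 k2]; split=> *; try exact: tri.
by apply: le_trans (ler_normB _ _) _; apply: lerD.
Qed.

Lemma kernel_le_mono g s cq cp s' cq' cp' : s <= s' -> cq <= cq' -> cp <= cp' ->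
  kernel_le g s cq cp -> kernel_le g s' cq' cp'.
Proof.
move=> ss' qq' pp' [h0 h1 h2].
by split=> *; [apply: le_trans ss'|apply: le_trans qq'|apply: le_trans pp'].
Qed.

(** For the sup bound, [g1] and [g2] are replaced by their sup norms and [g3] is integrated against
    [q]. Integrating a variable against [p] removes its kernel at the price [cp]; of the remaining
    kernels one is integrated against [q] and the other, if any, bounded by [s]. *)
Lemma triple_overlap_marginals g1 g2 g3 (s1 s2 s cq cp : R) :
  0 <= s1 -> s1 <= s -> s2 <= s -> 0 <= cp ->
  kernel_le g1 s1 cq cp -> kernel_le g2 s2 cq cp -> kernel_le g3 s cq cp ->
  marginals_le (p := p) (triple_overlap g1 g2 g3)
    (cq * s1 * s2) (cp * cq * s) (cp ^+ 2 * cq).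
Proof.
move=> s10 s1s s2s cp0 [h0 h1 h2] [k0 k1 k2] [l0 l1 l2].
have s20 (y : D) : 0 <= s2 by exact: le_trans (k0 y y).
have s0 : 0 <= s by exact: le_trans s1s.
have avg1 g (w : D -> R) : (forall d, \sum_y p y * `|g d y| <= cp) ->
    (forall d, 0 <= w d) ->
    \sum_x p x * (\sum_d q d * (w d * `|g d x|)) <= cp * \sum_d q d * w d.
  move=> gcp w0; under eq_bigr do rewrite mulr_sumr.
  rewrite exchange_big mulr_sumr; apply: ler_sum => d _ /=.
  rewrite [leRHS]mulrC; apply: le_trans (ler_wpM2l _ (gcp d)); rewrite ?mulr_ge0 //.
  by rewrite mulr_sumr; apply: ler_sum => y _; rewrite le_eqVlt; apply/orP; left; apply/eqP; ring.
have abs_le x y z : `|triple_overlap g1 g2 g3 x y z| <=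
    \sum_d q d * (`|g1 d x| * `|g2 d y| * `|g3 d z|).
  apply: le_trans (ler_norm_sum _ _ _) _; apply: ler_sum => d _.
  by rewrite !normrM (ger0_norm (q_ge0 d)).
have pair_le g g' (y z : D) : (forall d y, `|g d y| <= s) ->
    (forall y, \sum_d q d * `|g' d y| <= cq) ->
    \sum_d q d * (`|g d y| * `|g' d z|) <= cq * s.
  move=> gs g'c; rewrite [leRHS]mulrC; apply: le_trans (ler_wpM2l s0 (g'c z)).
  rewrite mulr_sumr; apply: ler_sum => d _; rewrite mulrCA.
  by rewrite ler_wpM2r // mulr_ge0.
have gs1 d y : `|g1 d y| <= s by apply: le_trans s1s.
have gs2 d y : `|g2 d y| <= s by apply: le_trans s2s.
have S1 y z : \sum_x p x * `|triple_overlap g1 g2 g3 x y z| <=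
    cp * \sum_d q d * (`|g2 d y| * `|g3 d z|).
  apply: le_trans (avg1 g1 _ h2 _) => [|d]; last exact: mulr_ge0.
  apply: ler_sum => x _; rewrite ler_wpM2l //; apply: le_trans (abs_le _ _ _) _.
  by apply: ler_sum => d _; rewrite le_eqVlt; apply/orP; left; apply/eqP; ring.
have S2 x z : \sum_y p y * `|triple_overlap g1 g2 g3 x y z| <=
    cp * \sum_d q d * (`|g1 d x| * `|g3 d z|).
  apply: le_trans (avg1 g2 _ k2 _) => [|d]; last exact: mulr_ge0.
  apply: ler_sum => y _; rewrite ler_wpM2l //; apply: le_trans (abs_le _ _ _) _.
  by apply: ler_sum => d _; rewrite le_eqVlt; apply/orP; left; apply/eqP; ring.
have S3 x y : \sum_z p z * `|triple_overlap g1 g2 g3 x y z| <=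
    cp * \sum_d q d * (`|g1 d x| * `|g2 d y|).
  apply: le_trans (avg1 g3 _ l2 _) => [|d]; last exact: mulr_ge0.
  by apply: ler_sum => z _; rewrite ler_wpM2l.
have avg2 g g' (y : D) (F : D -> R) : (forall d, \sum_y p y * `|g d y| <= cp) ->
    (forall y, \sum_d q d * `|g' d y| <= cq) ->
    (forall x, F x <= cp * \sum_d q d * (`|g' d y| * `|g d x|)) ->
    \sum_x p x * F x <= cp ^+ 2 * cq.
  move=> gc g'c Fle.
  apply: (@le_trans _ _ (cp * (\sum_x p x * \sum_d q d * (`|g' d y| * `|g d x|)))).
    rewrite mulr_sumr; apply: ler_sum => x _; rewrite [leRHS]mulrCA.
    by rewrite ler_wpM2l.
  rewrite expr2 -mulrA ler_wpM2l //; apply: le_trans (avg1 _ _ gc _) _ => //.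
  by rewrite ler_wpM2l.
have swap g g' (x y : D) : \sum_d q d * (`|g d x| * `|g' d y|) =
    \sum_d q d * (`|g' d y| * `|g d x|).
  by apply: eq_bigr => d _; rewrite (mulrC `|g d x|).
split.
- move=> x y z; apply: le_trans (abs_le _ _ _) _.
  have -> : cq * s1 * s2 = s1 * s2 * cq by ring.
  apply: le_trans (ler_wpM2l _ (l1 z)); last by rewrite mulr_ge0 // (s20 x).
  rewrite mulr_sumr; apply: ler_sum => d _; rewrite mulrCA.
  by rewrite ler_wpM2r ?mulr_ge0 //; apply: ler_pM.
- split=> [y z|x z|x y]; rewrite -mulrA.
  + by apply: le_trans (S1 y z) _; rewrite ler_wpM2l //; apply: pair_le.
  + by apply: le_trans (S2 x z) _; rewrite ler_wpM2l //; apply: pair_le.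
  + by apply: le_trans (S3 x y) _; rewrite ler_wpM2l //; apply: pair_le.
- split=> [z|y|x].
  + by apply: (avg2 g1 g3 z _ h2 l1) => x; rewrite -swap.
  + by apply: (avg2 g1 g2 y _ h2 k1) => x; rewrite -swap.
  + by apply: (avg2 g2 g1 x _ k2 h1) => y.
Qed.

Context (kap1 kap2 kap3 : D -> D -> R).

Definition sub_kernel g g' (d y : D) : R := g d y - g' d y.

Definition phi_kernel (x y z : D) : R :=
  triple_overlap kap1 kap1 kap1 x y z +
  3 * triple_overlap kap1 (sub_kernel kap3 kap1) kap1 x y z +
  3 * triple_overlap kap1 (sub_kernel kap3 kap1) (sub_kernel kap3 kap1) x y z +
  3 * triple_overlap (sub_kernel kap2 kap1) (sub_kernel kap2 kap1)
        (sub_kernel kap3 kap2) x y z +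
  triple_overlap (sub_kernel kap2 kap1) (sub_kernel kap2 kap1)
        (sub_kernel kap2 kap1) x y z.

(* Each of the five integrals, counted 1 + 3 + 3 + 3 + 1 = 11 times, satisfies
   the bounds 128 W, 32 M k3 and 8 M^2. *)
Lemma phi_kernel_marginals (k1 k2 k3 M W : R) :
  0 <= M -> 0 <= k1 -> k1 <= k2 -> k2 <= k3 ->
  kernel_le kap1 (4 * k1) 1 M -> kernel_le kap2 (4 * k2) 1 M ->
  kernel_le kap3 (4 * k3) 1 M ->
  k1 * k3 <= W -> k2 ^+ 2 <= W ->
  marginals_le (p := p) phi_kernel (1408 * W) (352 * M * k3) (88 * M ^+ 2).
Proof.
move=> M_ge0 k1_ge0 k12 k23 kap1_le kap2_le kap3_le k13W k2W.
(* Kernels and their differences get the common constants [2] and [2 * M]; the sup norm of a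
   difference is at most 8 times the larger level. *)
have le2 (s s' : R) g : s <= s' -> kernel_le g s 1 M -> kernel_le g s' 2 (2 * M).
  by move=> ss'; apply: kernel_le_mono => //; lra.
have sub2 (s s' s'' : R) g g' : s + s' <= s'' -> kernel_le g s 1 M ->
    kernel_le g' s' 1 M -> kernel_le (sub_kernel g g') s'' 2 (2 * M).
  move=> ss' gs gs'; apply: kernel_le_mono (kernel_leB gs gs') => //; lra.
have k1le : kernel_le kap1 (4 * k1) 2 (2 * M) by apply: le2 kap1_le.
have k1le' : kernel_le kap1 (8 * k3) 2 (2 * M) by apply: le2 kap1_le; lra.
have k31 : kernel_le (sub_kernel kap3 kap1) (8 * k3) 2 (2 * M).
  by apply: sub2 kap3_le kap1_le; lra.
have k21 : kernel_le (sub_kernel kap2 kap1) (8 * k2) 2 (2 * M).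
  by apply: sub2 kap2_le kap1_le; lra.
have k21' : kernel_le (sub_kernel kap2 kap1) (8 * k3) 2 (2 * M).
  by apply: sub2 kap2_le kap1_le; lra.
have k32 : kernel_le (sub_kernel kap3 kap2) (8 * k3) 2 (2 * M).
  by apply: sub2 kap3_le kap2_le; lra.
have k3_ge0 : 0 <= k3 by lra.
have k11W : k1 ^+ 2 <= W.
  by apply: le_trans k13W; rewrite expr2 ler_wpM2l //; lra.
have W_ge0 : 0 <= W by apply: le_trans k11W; exact: sqr_ge0.
have Mk_ge0 : 0 <= M * k3 by exact: mulr_ge0.
have M2_ge0 : 0 <= M ^+ 2 by exact: sqr_ge0.
rewrite expr2 in k2W; rewrite expr2 in k11W.
(* The worst sup bound is [2 * (8 * k2) ^+ 2], hence [128 * W]; the other two are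
   [2 * M * 2 * (8 * k3)] and [(2 * M) ^+ 2 * 2]. *)
have term g1 g2 g3 (s1 s2 : R) : 0 <= s1 -> s1 <= 8 * k3 -> s2 <= 8 * k3 ->
    2 * s1 * s2 <= 128 * W -> kernel_le g1 s1 2 (2 * M) ->
    kernel_le g2 s2 2 (2 * M) -> kernel_le g3 (8 * k3) 2 (2 * M) ->
    marginals_le (p := p) (triple_overlap g1 g2 g3) (128 * W) (32 * M * k3) (8 * M ^+ 2).
  move=> s10 s1s s2s sW h1 h2 h3.
  apply: marginals_le_mono (triple_overlap_marginals s10 s1s s2s _ h1 h2 h3) => //; try nra.
have t1 := term _ _ _ (4 * k1) (4 * k1) _ _ _ _ k1le k1le k1le'.
have t2 := term _ _ _ (4 * k1) (8 * k3) _ _ _ _ k1le k31 k1le'.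
have t3 := term _ _ _ (4 * k1) (8 * k3) _ _ _ _ k1le k31 k31.
have t4 := term _ _ _ (8 * k2) (8 * k2) _ _ _ _ k21 k21 k32.
have t5 := term _ _ _ (8 * k2) (8 * k2) _ _ _ _ k21 k21 k21'.
have n3 : `|3| = 3 :> R by rewrite ger0_norm.
have : marginals_le (p := p) phi_kernel _ _ _ :=
  marginals_leD p_ge0 (marginals_leD p_ge0 (marginals_leD p_ge0
    (marginals_leD p_ge0 (t1 ltac:(lra) ltac:(lra) ltac:(lra) ltac:(nra))
      (marginals_leZ 3 (t2 ltac:(lra) ltac:(lra) ltac:(lra) ltac:(nra))))
    (marginals_leZ 3 (t3 ltac:(lra) ltac:(lra) ltac:(lra) ltac:(nra))))
    (marginals_leZ 3 (t4 ltac:(lra) ltac:(lra) ltac:(lra) ltac:(nra))))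
    (t5 ltac:(lra) ltac:(lra) ltac:(lra) ltac:(nra)).
by apply: marginals_le_mono; rewrite !n3; lra.
Qed.

End KernelProducts.

(** * Moments of normalized U-statistics of order three *)

Section UStatisticMoments.
Context {R : realFieldType} {D : finType} {p : D -> R}.
Context (p_ge0 : forall y, 0 <= p y) (p_sum1 : \sum_y p y = 1).

(** The [L] of the triple sum bound: the leading 1 makes it at least 1, and the three terms of the
    numerator serve the three conditions on [T1] and [T2]. *)
Definition ustat_ratio (Q M a1 A3 : R) : R :=
  1 + (352 * M + 88 * M ^+ 2 / a1 + 88 * M ^+ 2) / (1408 * Q).

(** The factor 324 is [4 * 2 ^+ 2 * (81 / 4)], where [81 / 4] comes from the squared
    normalization. *)
Definition ustat_const (Q M a1 A3 : R) (m : nat) : R :=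
  324 * (ustat_ratio Q M a1 A3 * (1408 * Q) * ((6 * m).+1%:R ^+ 3 + 1)) ^+ 2 * (1 + A3).

Lemma ustat_moment_le (n m : nat) (H : D -> D -> D -> R) (Q M a1 A3 k3 : R) :
  (2 < n)%N -> 0 < Q -> 0 <= M -> 0 < a1 -> 0 < A3 ->
  a1 * n%:R <= k3 -> k3 <= A3 * n%:R ^+ 2 ->
  marginals_le (p := p) H (1408 * (Q * (n%:R * k3))) (352 * M * k3) (88 * M ^+ 2) ->
  expect (p := p) (fun c : {ffun 'I_n -> D} =>
    ((n%:R * (n%:R - 1) * (n%:R - 2))^-1 *
      \sum_(b | distinct3 b) (lift3 H b c - mean3 (p := p) H)) ^+ (2 * m))
  <= (ustat_const Q M a1 A3 m * (k3 / n%:R ^+ 2)) ^+ m.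
Proof.
move=> n3 Q0 M0 a10 A30 k3_lo k3_hi H_le.
have n3R : 3 <= n%:R :> R by rewrite ler_nat.
have [N NE] : {N : R | N = n%:R} by exists n%:R.
rewrite -NE in n3R k3_lo k3_hi H_le *.
have N0 : 0 < N by lra.
have k30 : 0 < k3 by apply: lt_le_trans k3_lo; rewrite mulr_gt0.
have M20 : 0 <= M ^+ 2 by exact: sqr_ge0.
have M2a0 : 0 <= M ^+ 2 / a1 by rewrite divr_ge0 // ltW.
set L := ustat_ratio Q M a1 A3.
have c00 : 0 < 1408 * Q by rewrite mulr_gt0.
have L1 : 1 <= L.
  by rewrite lerDl divr_ge0 ?(ltW c00) // !addr_ge0 ?mulr_ge0 ?invr_ge0 ?(ltW a10) //.
have Lc : 352 * M + 88 * (M ^+ 2 / a1) + 88 * M ^+ 2 <= L * (1408 * Q).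
  have -> : L * (1408 * Q) = 1408 * Q + (352 * M + 88 * (M ^+ 2 / a1) + 88 * M ^+ 2).
    by rewrite /L /ustat_ratio; field; rewrite !gt_eqF.
  by rewrite lerDr ltW.
(* The factor [1 + A3] yields both [mu >= 1], from [k3 <= A3 * N ^+ 2], and [N ^+ 2 <= mu * k3]. *)
set mu := (1 + A3) * (N ^+ 2 / k3).
have mu_k3 : mu * k3 = (1 + A3) * N ^+ 2 by rewrite /mu -!mulrA mulVf ?mulr1 ?gt_eqF.
have mu1 : 1 <= mu.
  rewrite /mu mulrA ler_pdivlMr // mul1r; apply: le_trans k3_hi _.
  by rewrite mulrDl mul1r lerDr sqr_ge0.
have mu0 : 0 <= mu by apply: le_trans mu1.
set S := 1408 * (Q * (N * k3)) in H_le *.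
have SE : S = 1408 * Q * (N * k3) by rewrite /S !mulrA.
have S0 : 0 <= S by rewrite SE !mulr_ge0 // ltW.
have Nk0 : 0 <= N * k3 by rewrite mulr_ge0 // ltW.
have T1 : N * (352 * M * k3) <= L * S.
  have -> : N * (352 * M * k3) = 352 * M * (N * k3) by ring.
  rewrite SE [leRHS]mulrA ler_wpM2r //; lra.
have T2 : N ^+ 2 * (88 * M ^+ 2) <= L * S.
  (* From [a1 * N <= k3], one factor [N] is traded for [k3 / a1]. *)
  apply: (@le_trans _ _ (88 * (M ^+ 2 / a1) * (N * k3))).
    have -> : N ^+ 2 * (88 * M ^+ 2) = 88 * (M ^+ 2 / a1) * (N * (a1 * N)).
      by field; rewrite gt_eqF.
    by apply: ler_wpM2l; [exact: mulr_ge0|apply: ler_wpM2l => //; exact: ltW].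
  rewrite SE [leRHS]mulrA ler_wpM2r //; lra.
have T3 : N ^+ 3 * (88 * M ^+ 2) <= L * mu * S.
  have -> : L * mu * S = L * (1408 * Q) * (N * (mu * k3)) by rewrite SE; ring.
  have -> : N ^+ 3 * (88 * M ^+ 2) = 88 * M ^+ 2 * (N * N ^+ 2) by ring.
  apply: ler_pM => //; first lra.
  - by rewrite mulr_ge0 ?exprn_ge0 // ltW.
  - lra.
  - rewrite mu_k3 ler_wpM2l ?(ltW N0) //. by rewrite ler_peMl ?exprn_ge0 ?lerDl // ltW.
have J0 : (0 < #|'I_n|)%N by rewrite card_ord (leq_trans _ n3).
have := @triple_sum_moment_le _ _ 'I_n _ p_ge0 p_sum1 H S _ _ L mu m J0 H_le L1 mu1 S0.
rewrite card_ord -NE => /(_ T1 T2 T3).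
set E1 := expect _ => E1_le.
rewrite (eq_expect (g' := fun c => ((N * (N - 1) * (N - 2))^-1) ^+ (2 * m) *
  (\sum_(b | distinct3 b) (lift3 H b c - mean3 (p := p) H)) ^+ (2 * m))); last first.
  by move=> c; rewrite exprMn.
rewrite expectZ -/E1.
have C0 : 0 < N * (N - 1) * (N - 2) by rewrite !mulr_gt0 //; lra.
apply: le_trans (ler_wpM2l _ E1_le) _; first by rewrite exprn_ge0 // invr_ge0 ltW.
set V := (6 * m).+1%:R ^+ 3 + 1.
have V0 : 0 <= V by rewrite addr_ge0 // exprn_ge0.
have base0 z : 0 <= z ^+ 2 * (4 * (2 * (L * S) * V) ^+ 2 * mu).
  apply: mulr_ge0; first exact: sqr_ge0.
  by apply: mulr_ge0 => //; apply: mulr_ge0 => //; exact: sqr_ge0.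
rewrite !exprM -!exprMn lerXn2r ?nnegrE //.
- apply: mulr_ge0; last by rewrite divr_ge0 ?sqr_ge0 // ltW.
  apply: mulr_ge0; last by rewrite addr_ge0 // ltW.
  by apply: mulr_ge0 => //; exact: sqr_ge0.
have N30 : 0 < N ^+ 3 by exact: exprn_gt0.
have N3' : 0 < 2 / 9 * N ^+ 3 by lra.
(* For [N >= 3], [N - 1 >= 2 / 3 * N] and [N - 2 >= N / 3]. *)
have C1 : (N * (N - 1) * (N - 2))^-1 <= (2 / 9 * N ^+ 3)^-1.
  rewrite lef_pV2 ?posrE //.
  have -> : 2 / 9 * N ^+ 3 = N * (2 / 3 * N) * (N / 3) by field.
  by apply: ler_pM; rewrite ?mulr_ge0 ?ler_wpM2l //; lra.
have C2 : ((N * (N - 1) * (N - 2))^-1) ^+ 2 <= 81 / 4 / N ^+ 6.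
  have -> : 81 / 4 / N ^+ 6 = ((2 / 9 * N ^+ 3)^-1) ^+ 2 by field; rewrite gt_eqF.
  by apply: lerXn2r => //; rewrite nnegrE invr_ge0 ltW.
apply: le_trans (ler_wpM2r _ C2) _.
  by apply: mulr_ge0 => //; apply: mulr_ge0 => //; exact: sqr_ge0.
rewrite /ustat_const -/L -/V SE /mu le_eqVlt; apply/orP; left; apply/eqP.
by field; rewrite !gt_eqF.
Qed.

End UStatisticMoments.

From mathcomp Require Import all_classical all_reals all_analysis.
From mathcomp Require Import measurable_realfun.

Import numFieldNormedType.Exports.

Local Open Scope classical_set_scope.
Local Open Scope ring_scope.

(** * Reduction to finitely many bins *)

Section FiniteImage.
Context {d : measure_display} {T : measurableType d} {R : realType}.
Context (mu : {measure set T -> \bar R}).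

Lemma integral_finite_image (I : finType) (A : set T) (b : T -> I) (F : I -> R) :
  measurable A -> (mu A < +oo)%E -> (forall i, measurable (b @^-1` [set i])) ->
  (\int[mu]_(x in A) (F (b x))%:E =
   (\sum_i F i * fine (mu (A `&` b @^-1` [set i])))%:E)%E.
Proof.
move=> mA Aoo mb.
have mAb i : measurable (A `&` b @^-1` [set i]) by exact: measurableI.
have Aboo i : (mu (A `&` b @^-1` [set i]) < +oo)%E.
  by apply: le_lt_trans Aoo; apply: le_measure; rewrite ?inE.
rewrite (eq_integral (fun x => \sum_i ((F i)%:E * (\1_(b @^-1` [set i]) x)%:E)%E)); last first.
  move=> x _; rewrite (bigD1 (b x)) //= big1 => [|i ib]; last first.
    rewrite indicE memNset ?mule0 //= => bxi.
    by rewrite -bxi eqxx in ib.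
  by rewrite indicE mem_set // mule1 adde0.
have int1 i : mu.-integrable A (fun x => (\1_(b @^-1` [set i]) x)%:E).
  apply/integrableP; split; first exact/measurable_EFinP.
  rewrite (eq_integral (fun x => (\1_(b @^-1` [set i]) x)%:E)).
    by rewrite integral_indic // setIC.
  by move=> x _; rewrite gee0_abs // lee_fin.
rewrite integral_sum // => [|i]; last exact: integrableZl.
rewrite -sumEFin; apply: eq_bigr => i _.
rewrite integralZl // integral_indic // setIC EFinM fineK //.
by rewrite ge0_fin_numE.
Qed.

(** The integral of a nonnegative function is a supremum over the simple functions below it, so
    monotonicity is an inclusion of sets. It serves to bound the integral of the density over a
    bin. *)
Lemma ge0_le_integral_nonmeasurable (A : set T) (f g : T -> \bar R) :
  (forall x, A x -> (0 <= f x)%E) -> (forall x, A x -> (f x <= g x)%E) ->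
  (\int[mu]_(x in A) f x <= \int[mu]_(x in A) g x)%E.
Proof.
move=> f0 fg; rewrite integral_mkcond [leRHS]integral_mkcond.
have fg' x : ((f \_ A) x <= (g \_ A) x)%E.
  by rewrite !patchE; case: ifPn => // /set_mem; exact: fg.
have f0' x : (0 <= (f \_ A) x)%E.
  by rewrite patchE; case: ifPn => // /set_mem; exact: f0.
rewrite !ge0_integralTE => [|x|//]; last exact: le_trans (fg' x).
apply: le_ereal_sup => _ [h hf <-]; exists h => // x.
exact: le_trans (fg' x).
Qed.

End FiniteImage.

(** * Dyadic bins and the Haar kernel *)

Section DyadicBins.
Context {R : realType}.

(* [None] is the bin of the points outside (0, 1]. *)
Definition bin (m : nat) (x : R) : option 'I_m :=
  [pick j : 'I_m | x \in `](j%:R / m%:R), (j.+1%:R / m%:R)]].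

(** The choice in [bin] is unambiguous: if bins [i] and [k] contain [x], then
    [i / m < x <= (k + 1) / m] gives [i <= k], and symmetry gives equality. *)
Lemma bin_eqP (m : nat) (x : R) (j : 'I_m) :
  (bin m x == Some j) = (x \in `](j%:R / m%:R), (j.+1%:R / m%:R)]).
Proof.
have m0 : 0 < m%:R :> R by rewrite ltr0n; case: (m) (j) => // -[].
have bins_le (i k : 'I_m) : x \in `](i%:R / m%:R), (i.+1%:R / m%:R)] ->
    x \in `](k%:R / m%:R), (k.+1%:R / m%:R)] -> (i <= k)%N.
  rewrite !in_itv /= => /andP[ix _] /andP[_ xk]; move: (lt_le_trans ix xk).
  by rewrite ltr_pM2r ?invr_gt0 // ltr_nat ltnS.
rewrite /bin; case: pickP => [k xk|no]; last by rewrite no.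
apply/eqP/idP => [[<-] //|xj]; congr Some.
by apply/val_inj/eqP; rewrite eqn_leq !bins_le.
Qed.

(** The case on [u] makes the kernel vanish when both bins are [None]. *)
Definition bin_kernel (m : nat) (u v : option 'I_m) : R :=
  if u is Some _ then m%:R *+ (u == v) else 0.

Lemma haar_kernel_binE (m : nat) (x y : R) :
  haar_kernel_pow2 m x y = bin_kernel (bin m x) (bin m y).
Proof.
rewrite /haar_kernel_pow2 big_add1 /= big_mkord.
have ind z (j : 'I_m) : \1_(`](j%:R / m%:R), (j.+1%:R / m%:R)]%classic) z =
    (bin m z == Some j)%:R :> R.
  by rewrite indicE bin_eqP mem_setE.
under eq_bigr do rewrite !ind.
rewrite /bin_kernel; case: (bin m x) => [j|]; last first.
  by rewrite big1 ?mulr0 // => j _; rewrite mul0r.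
rewrite (bigD1 j) //= eqxx mul1r big1 ?addr0 => [|i ij].
  by rewrite mulr_natr eq_sym.
by rewrite (_ : (Some j == Some i) = false) ?mul0r // eq_sym; apply/negbTE.
Qed.

Lemma preimage_bin_Some (m : nat) (j : 'I_m) :
  bin m @^-1` [set Some j] = `](j%:R / m%:R), (j.+1%:R / m%:R)]%classic.
Proof.
apply/seteqP; split=> x.
  by move=> /= /eqP; rewrite bin_eqP.
by move=> xj; apply/eqP; rewrite bin_eqP.
Qed.

Lemma measurable_preimage_bin (m : nat) (u : option 'I_m) :
  measurable (bin m @^-1` [set u]).
Proof.
have mS (j : 'I_m) : measurable (bin m @^-1` [set Some j]).
  by rewrite preimage_bin_Some; exact: measurable_itv.
case: u => //.
rewrite (_ : _ @^-1` _ = ~` \bigcup_(j in [set: 'I_m]) (bin m @^-1` [set Some j])).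
  by apply: measurableC; apply: fin_bigcup_measurable.
apply/seteqP; split=> x /=; first by move=> bx [j _] /=; rewrite bx.
by case E: (bin m x) => [j|//] nb; exfalso; apply: nb; exists j.
Qed.

End DyadicBins.

Section JointLaw.
Context {d : measure_display} {T : measurableType d} {R : realType}.
Context (P : probability T R) {n : nat} (X : 'I_n -> {RV P >-> R}).
Context {D : finType} (B : R -> D) (p : D -> R).
Context (mB : forall y, measurable (B @^-1` [set y])).
Context (indepX : mutually_independent X).
Context (law : forall i y, P (X i @^-1` (B @^-1` [set y])) = (p y)%:E).

(** The event that the bins form [c] is an intersection of independent events, so the vector of bins
    follows the product weight. *)
Lemma expectation_bins (F : {ffun 'I_n -> D} -> R) :
  'E_P[fun w => F [ffun i => B (X i w)]]%E = (expect (p := p) F)%:E.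
Proof.
pose b w := [ffun i => B (X i w)].
have bE c : b @^-1` [set c] =
    \bigcap_(i in [set` [set: 'I_n]%SET]) (X i @^-1` (B @^-1` [set c i])).
  apply/seteqP; split=> w /=.
    by move=> <- i _ /=; rewrite ffunE.
  by move=> h; apply/ffunP => i; rewrite ffunE; apply: h => /=; rewrite inE.
have mXB i y : measurable (X i @^-1` (B @^-1` [set y])).
  by rewrite -[_ @^-1` _]setTI; apply: measurable_funPT.
rewrite unlock (integral_finite_image (b := b) F) //=; first last.
- move=> c; rewrite bE; apply: fin_bigcap_measurable => //.
- by rewrite probability_setT ltry.
congr (_%:E); apply: eq_bigr => c _; rewrite mulrC setTI; congr (_ * _).
rewrite bE indepX // (eq_bigr (fun i => (p (c i))%:E)) => [|i _]; last exact: law.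
by rewrite prodEFin /=; apply: eq_bigl => i; rewrite inE.
Qed.

End JointLaw.

Section BinMasses.
Context {d : measure_display} {T : measurableType d} {R : realType}.
Context (mu : {measure set T -> \bar R}) (A : set T).
Context (mA : measurable A) (Aoo : (mu A < +oo)%E).

(** Fine bins are grouped into coarse ones: both sides are the same integral. *)
Lemma sum_mass_proj (I I' : finType) (b : T -> I) (pr : I -> I') (F : I' -> R) :
  (forall i, measurable (b @^-1` [set i])) ->
  (forall i, measurable ((pr \o b) @^-1` [set i])) ->
  \sum_i fine (mu (A `&` b @^-1` [set i])) * F (pr i) =
  \sum_i fine (mu (A `&` (pr \o b) @^-1` [set i])) * F i.
Proof.
move=> mb mpb.
under eq_bigr do rewrite mulrC.
under [RHS]eq_bigr do rewrite mulrC.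
apply: EFin_inj.
by rewrite -(integral_finite_image (F \o pr) mA Aoo mb) -(integral_finite_image F mA Aoo mpb).
Qed.

(** The kernel equals [m] on the single bin [v], of mass at most [M / m], and vanishes elsewhere. *)
Lemma sum_mass_bin_kernel (I : finType) (X : T -> R) (b : T -> I) (m : nat)
    (pr : I -> option 'I_m) (v : option 'I_m) (M : R) :
  (0 < m)%N -> 0 <= M ->
  (forall i, measurable (b @^-1` [set i])) ->
  (forall u, measurable (X @^-1` (bin m @^-1` [set u]))) ->
  (forall w, pr (b w) = bin m (X w)) ->
  (forall j : 'I_m, (mu (A `&` X @^-1` (bin m @^-1` [set Some j])) <= (M / m%:R)%:E)%E) ->
  \sum_i fine (mu (A `&` b @^-1` [set i])) * bin_kernel (pr i) v <= M.
Proof.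
move=> m0 M0 mb mX prb massX.
have prbE : pr \o b = bin m \o X by apply/funext => w /=.
rewrite (sum_mass_proj (fun u => bin_kernel u v) mb) prbE //.
case: v => [j|]; last first.
  by rewrite big1 // => -[j|] _; rewrite /= ?mulr0.
rewrite (bigD1 (Some j)) //= eqxx big1 ?addr0 => [|[i|] ij]; rewrite ?mulr0 //; last first.
  by rewrite /bin_kernel (negbTE ij) mulr0n mulr0.
have mR : 0 < m%:R :> R by rewrite ltr0n.
rewrite -ler_pdivlMr // -lee_fin comp_preimage fineK; first exact: massX.
rewrite ge0_fin_numE //; apply: le_lt_trans (massX j) _; exact: ltry.
Qed.

End BinMasses.


Section BinBounds.
Context {R : realType}.
Local Notation lambda := (@lebesgue_measure R).

Lemma lebesgue_bin_le (m : nat) (j : 'I_m) (A : set R) : measurable A ->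
  (lambda (A `&` bin m @^-1` [set Some j]) <= (m%:R^-1)%:E)%E.
Proof.
move=> mA; have m0 : 0 < m%:R :> R by rewrite ltr0n; case: (m) (j) => // -[].
apply: (@le_trans _ _ (lambda (bin m @^-1` [set Some j]))).
  apply: le_measure; rewrite ?inE; [|exact: measurable_preimage_bin|exact: subIsetr].
  by apply: measurableI => //; exact: measurable_preimage_bin.
rewrite preimage_bin_Some lebesgue_measure_itv /= lte_fin ltr_pM2r ?invr_gt0 //.
by rewrite ltr_nat ltnSn -EFinB -mulrBl -natrB // subSnn mul1r.
Qed.

Lemma density_bin_le {d : measure_display} {T : measurableType d}
    (P : probability T R) (X : {RV P >-> R}) (f : R -> R) (M : R) (m : nat)
    (j : 'I_m) :
  has_density01 f X -> 0 <= M -> (forall x, x \in `[0, 1] -> 0 <= f x <= M) ->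
  (P (X @^-1` (bin m @^-1` [set Some j])) <= (M / m%:R)%:E)%E.
Proof.
move=> fX M0 f_le; rewrite -[leLHS]/(distribution P X _).
rewrite fX; last exact: measurable_preimage_bin.
have mA : measurable (bin m @^-1` [set Some j] `&` `[(0:R), 1]%classic).
  by apply: measurableI; [exact: measurable_preimage_bin|exact: measurable_itv].
apply: (@le_trans _ _ (\int[lambda]_(x in bin m @^-1` [set Some j] `&` `[0%R, 1%R]) M%:E)%E).
  apply: ge0_le_integral_nonmeasurable => x [_ /= x01]; rewrite lee_fin;
  by have /andP[] := f_le x x01.
rewrite integral_cst // setIC EFinM lee_pmul ?lee_fin //.
by apply: lebesgue_bin_le; exact: measurable_itv.
Qed.

End BinBounds.

Section Discretization.
Context {R : realType}.
Local Notation lambda := (@lebesgue_measure R).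

Lemma ustat3_lift3 (D : finType) (B : R -> D) (n : nat) (xs : 'I_n -> R)
    (h : R -> R -> R -> R) (h' : D -> D -> D -> R) :
  (forall x y z, h x y z = h' (B x) (B y) (B z)) ->
  ustat3 xs h = (n%:R * (n%:R - 1) * (n%:R - 2))^-1 *
    \sum_(b | distinct3 b) lift3 h' b [ffun i => B (xs i)].
Proof.
move=> hh'; congr (_ * _).
rewrite (eq_bigr (fun i1 => \sum_(i2 < n | i2 != i1)
  \sum_(i3 < n | (i3 != i1) && (i3 != i2)) lift3 h' (i1, i2, i3) [ffun i => B (xs i)])).
  by rewrite pair_big_dep pair_big_dep.
move=> i1 _; apply: eq_bigr => i2 _; apply: eq_bigr => i3 _.
by rewrite hh' /lift3 !ffunE.
Qed.

Lemma Rintegral_triple_overlap (D : finType) (B : R -> D)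
    (G1 G2 G3 : R -> R -> R) (g1 g2 g3 : D -> D -> R) (x y z : R) :
  (forall d, measurable (B @^-1` [set d])) ->
  (forall u v, G1 u v = g1 (B u) (B v)) -> (forall u v, G2 u v = g2 (B u) (B v)) ->
  (forall u v, G3 u v = g3 (B u) (B v)) ->
  \int[lambda]_(u in `[0, 1]) (G1 u x * G2 u y * G3 u z) =
  triple_overlap (fun d => fine (lambda (`[0, 1]%classic `&` B @^-1` [set d])))
    g1 g2 g3 (B x) (B y) (B z).
Proof.
move=> mB G1E G2E G3E; rewrite /Rintegral.
pose F d := g1 d (B x) * g2 d (B y) * g3 d (B z).
transitivity (fine (\int[lambda]_(u in `[0%R, 1%R]) (F (B u))%:E)%E).
  by congr fine; apply: eq_integral => u _; rewrite G1E G2E G3E.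
rewrite (integral_finite_image F) //=; first by apply: eq_bigr => d _; rewrite mulrC.
by rewrite lebesgue_measure_itv /= lte_fin ltr01 oppr0 adde0 ltry.
Qed.

(** The ceiling is below [k + 1 <= 2 * k], and rounding up to a power of two at most doubles it. *)
Lemma next_pow2_bounds (k : R) : 1 <= k ->
  (0 < next_pow2 k)%N /\ (next_pow2 k)%:R <= 4 * k.
Proof.
move=> k1; split; first by rewrite expn_gt0.
rewrite /next_pow2; set c := `|Num.ceil k|%N.
have ck : c%:R < k + 1.
  have c0 : 0 <= Num.ceil k by rewrite ceil_ge0 (lt_le_trans _ k1) // ltrN10.
  rewrite -[c%:R]/(c%:~R) gez0_abs //.
  have := ceilB1_lt k. lra.
have [c1|c1] := leqP c 1.
  have -> : up_log 2 c = 0%N by case: c c1 {ck} => [|[|]].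
  by rewrite expn0; lra.
have /andP[lo _] := up_log_bounds (isT : (1 < 2)%N) c1.
have : (2 ^ up_log 2 c)%:R <= 2 * c%:R :> R.
  rewrite -natrM ler_nat -(prednK (n := up_log 2 c)) ?up_log_gt0 //.
  by rewrite expnS leq_pmul2l // ltnW.
lra.
Qed.

End Discretization.

(** * The estimator *)

Section HaarEstimator.
Context {R : realType}.
Local Notation lambda := (@lebesgue_measure R).

Lemma bin_kernelC (m : nat) (u v : option 'I_m) :
  bin_kernel (R := R) u v = bin_kernel v u.
Proof. by case: u v => [i|] [j|] //=; rewrite eq_sym. Qed.

Lemma bin_kernel_ge0 (m : nat) (u v : option 'I_m) : 0 <= bin_kernel (R := R) u v.
Proof. by case: u => [i|] //=; rewrite mulrn_wge0. Qed.

Lemma bin_kernel_le (m : nat) (u v : option 'I_m) : bin_kernel (R := R) u v <= m%:R.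
Proof. by case: u => [i|] //=; case: eqP; rewrite ?mulr1n ?mulr0n. Qed.

Section Levels.
Context {D : finType} (B : R -> D) (mB : forall y, measurable (B @^-1` [set y])).

Definition lebesgue_mass (y : D) : R :=
  fine (lambda (`[0, 1]%classic `&` B @^-1` [set y])).

(** The bounds [1] and [M] reflect that a bin has Lebesgue mass at most [1 / m] and probability at
    most [M / m]. *)
Lemma bin_kernel_kernel_le (p : D -> R) (d : measure_display)
    (T : measurableType d) (P : probability T R) (X : {RV P >-> R}) (f : R -> R)
    (M : R) (m : nat) (pr : D -> option 'I_m) :
  (forall y, P (X @^-1` (B @^-1` [set y])) = (p y)%:E) ->
  (0 < m)%N -> (forall x, pr (B x) = bin m x) ->
  has_density01 f X -> 0 <= M -> (forall x, x \in `[0, 1] -> 0 <= f x <= M) ->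
  kernel_le lebesgue_mass p (fun y z => bin_kernel (pr y) (pr z)) m%:R 1 M.
Proof.
move=> law m0 prB fX M0 f_le; split=> [y z|z|y].
- by rewrite ger0_norm ?bin_kernel_ge0 // bin_kernel_le.
- under eq_bigr do rewrite ger0_norm ?bin_kernel_ge0 //.
  have m01 : measurable `[(0 : R), 1]%classic by exact: measurable_itv.
  have oo01 : (lambda `[0%R, 1%R]%classic < +oo)%E.
    by rewrite lebesgue_measure_itv /= lte_fin ltr01 oppr0 adde0 ltry.
  apply: (sum_mass_bin_kernel (mu := lambda) m01 oo01 (X := id) (b := B) (pr := pr)) => //.
  + by move=> u; exact: measurable_preimage_bin.
  + by move=> j; rewrite mul1r; apply: lebesgue_bin_le; exact: measurable_itv.
under eq_bigr do rewrite ger0_norm ?bin_kernel_ge0 // bin_kernelC.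
have pE y' : p y' = fine (P (setT `&` (B \o X) @^-1` [set y'])).
  by rewrite setTI comp_preimage law.
under eq_bigr do rewrite pE.
have mX A : measurable A -> measurable (X @^-1` A).
  by move=> mA; rewrite -[_ @^-1` _]setTI; apply: measurable_funPT.
have PT : (P setT < +oo)%E by rewrite probability_setT ltry.
apply: (sum_mass_bin_kernel (mu := P) measurableT PT (X := X) (b := B \o X) (pr := pr)) => //.
- by move=> i; rewrite comp_preimage; exact: mX.
- by move=> u; apply: mX; exact: measurable_preimage_bin.
- by move=> w /=; rewrite prB.
- by move=> j; rewrite setTI; apply: density_bin_le fX M0 f_le.
Qed.

(** The five U-statistics become sums over the same distinct triples, and each integral a
    [triple_overlap], so they merge into one sum. *)
Lemma phi_hat_lift3 (k1 k2 k3 : R) (kap1 kap2 kap3 : D -> D -> R) (n : nat)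
    (xs : 'I_n -> R) :
  (forall x y, haar_kernel k1 x y = kap1 (B x) (B y)) ->
  (forall x y, haar_kernel k2 x y = kap2 (B x) (B y)) ->
  (forall x y, haar_kernel k3 x y = kap3 (B x) (B y)) ->
  phi_hat k1 k2 k3 xs = (n%:R * (n%:R - 1) * (n%:R - 2))^-1 *
    \sum_(b | distinct3 b) lift3 (phi_kernel lebesgue_mass kap1 kap2 kap3) b
      [ffun i => B (xs i)].
Proof.
move=> e1 e2 e3.
have s21 x y : haar_kernel k2 x y - haar_kernel k1 x y = sub_kernel kap2 kap1 (B x) (B y).
  by rewrite /sub_kernel e1 e2.
have s31 x y : haar_kernel k3 x y - haar_kernel k1 x y = sub_kernel kap3 kap1 (B x) (B y).
  by rewrite /sub_kernel e1 e3.
have s32 x y : haar_kernel k3 x y - haar_kernel k2 x y = sub_kernel kap3 kap2 (B x) (B y).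
  by rewrite /sub_kernel e2 e3.
have U := fun G1 G2 G3 g1 g2 g3 h1 h2 h3 => @ustat3_lift3 R D B n xs _ _
  (fun x y z => @Rintegral_triple_overlap R D B G1 G2 G3 g1 g2 g3 x y z mB h1 h2 h3).
rewrite /phi_hat (U _ _ _ _ _ _ e1 e1 e1).
rewrite (U _ (fun x y => haar_kernel k3 x y - haar_kernel k1 x y) _ _ _ _ e1 s31 e1).
rewrite (U _ (fun x y => haar_kernel k3 x y - haar_kernel k1 x y)
  (fun x y => haar_kernel k3 x y - haar_kernel k1 x y) _ _ _ e1 s31 s31).
rewrite (U (fun x y => haar_kernel k2 x y - haar_kernel k1 x y)
  (fun x y => haar_kernel k2 x y - haar_kernel k1 x y)
  (fun x y => haar_kernel k3 x y - haar_kernel k2 x y) _ _ _ s21 s21 s32).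
rewrite (U (fun x y => haar_kernel k2 x y - haar_kernel k1 x y)
  (fun x y => haar_kernel k2 x y - haar_kernel k1 x y)
  (fun x y => haar_kernel k2 x y - haar_kernel k1 x y) _ _ _ s21 s21 s21).
rewrite -/lebesgue_mass ![3 * (_^-1 * _)]mulrCA -!mulrDr; congr (_ * _).
by rewrite !mulr_sumr -!big_split.
Qed.

End Levels.

(** * Real powers and rates *)

(** If [t <= a] the term 1 suffices; otherwise [t / a > 1], and raising its exponent from [q] to [m]
    increases it. *)
Lemma powR_le_add_exp (q a t : R) (m : nat) : 0 <= q -> q <= m%:R -> 0 < a -> 0 <= t ->
  t `^ q <= a `^ q * (1 + (a^-1 * t) ^+ m).
Proof.
move=> q0 qm a0 t0; have at0 : 0 <= a^-1 * t by rewrite mulr_ge0 // invr_ge0 ltW.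
have {1}-> : t = a * (a^-1 * t) by rewrite mulrA mulfV ?mul1r ?gt_eqF.
rewrite powRM ?(ltW a0) // ler_wpM2l ?powR_ge0 //.
have [le1|gt1] := leP (a^-1 * t) 1.
  apply: (@le_trans _ _ 1); last by rewrite lerDl exprn_ge0.
  have -> : 1 = 1 `^ q by rewrite powR1.
  by rewrite ge0_ler_powR // ?nnegrE.
apply: (@le_trans _ _ ((a^-1 * t) ^+ m)); last by rewrite lerDr.
by rewrite -powR_mulrn // ler_powR // ltW.
Qed.

(** Twice the upper exponent for [k2] is [(3 + 4 * beta) / (1 + 4 * beta) = 1 + 2 / (1 + 4 * beta)],
    so [k2 ^+ 2] is at most of order [n * k3]. *)
Lemma powR_rates (beta N : R) : 0 < beta -> 1 <= N ->
  N `^ (2 / (1 + 4 * beta)) <= N ^+ 2 /\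
  (N `^ ((3 / 2 + 2 * beta) / (1 + 4 * beta))) ^+ 2 =
    N * N `^ (2 / (1 + 4 * beta)).
Proof.
move=> b0 N1; have N0 : 0 < N by lra.
have b1 : 0 < 1 + 4 * beta by lra.
split.
  have -> : N ^+ 2 = N `^ 2%:R by rewrite powR_mulrn // ltW.
  by rewrite ler_powR // ler_pdivrMr //; lra.
have powRD' x y : N `^ x * N `^ y = N `^ (x + y).
  by rewrite powRD //; apply/implyP => _; rewrite gt_eqF.
rewrite expr2 powRD' -[X in _ = X * _]powRr1 ?(ltW N0) // powRD'; congr (powR N _).
by field; rewrite gt_eqF.
Qed.

Lemma le_sup_norm01 (beta C Mlow Mup : R) (f : R -> R) (x : R) :
  hoelder_densities beta C Mlow Mup f -> x \in `[0, 1] -> `|f x| <= sup_norm01 f.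
Proof.
move=> [[fC _] _ _] x01; apply: ub_le_sup; last by exists x.
by exists C => _ [y y01 <-]; apply: fC.
Qed.

End HaarEstimator.

(* [q] is real, so the power 2q of t is written (t ^+ 2) `^ q.
   [a1, A1] and [a3, A3] are the constants implicit in k1 ~ n and
   k3 ~ n^(2/(1+4 beta)).  The constant is a function of the sup norm and of
   the infimum of f, chosen knowing only q and these four constants; the
   threshold N is uniform in f and in the truncation levels. *)
Theorem theorem5p1 (R : realType) (q a1 A1 a3 A3 : R) (hq : 1 <= q)
    (ha1 : 0 < a1) (hA1 : 0 < A1) (ha3 : 0 < a3) (hA3 : 0 < A3) :
  exists c : R -> R -> R,
  forall (beta C Mlow Mup : R),
    0 < beta < 4^-1 -> 0 < C -> 0 < Mlow -> Mlow < Mup ->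
  exists N : nat,
  forall (n : nat) (k1 k2 k3 : R),
    (N <= n)%N ->
    k1 <= k2 -> k2 <= k3 ->
    a1 * n%:R <= k1 <= A1 * n%:R ->
    n%:R `^ ((3 / 2 - 2 * beta) / (1 + 4 * beta)) <= k2
      <= n%:R `^ ((3 / 2 + 2 * beta) / (1 + 4 * beta)) ->
    a3 * n%:R `^ (2 / (1 + 4 * beta)) <= k3
      <= A3 * n%:R `^ (2 / (1 + 4 * beta)) ->
  forall f : R -> R, hoelder_densities beta C Mlow Mup f ->
  forall (d : measure_display) (T : measurableType d) (P : probability T R)
    (X : 'I_n -> {RV P >-> R}),
    iid_density01 f X ->
    let phi : T -> R := fun w => phi_hat k1 k2 k3 (fun i => X i w) in
    ('E_P[fun w => (((phi w - fine 'E_P[phi]%E) ^+ 2) `^ q)%R]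
      <= (c (sup_norm01 f) (inf01 f) * (k3 / n%:R ^+ 2) `^ q)%R%:E)%E.
Proof.
have q0 : 0 <= q by apply: le_trans hq.
pose m := Num.bound q.
have qm : q <= m%:R by apply/ltW/archi_boundP.
(* [A1] bounds [k1 / n] and [a3^-1] bounds [k2 ^+ 2 / (n * k3)], so [Q * (n * k3)] dominates both
   [k1 * k3] and [k2 ^+ 2]. *)
pose Q := A1 + a3^-1.
have Q0 : 0 < Q by rewrite addr_gt0 ?invr_gt0.
exists (fun M _ => 1 + ustat_const Q M a1 A3 m ^+ m).
move=> beta C Mlow Mup /andP[beta0 _] C0 Mlow0 _.
(* [n >= 3] makes the normalization of the U-statistic positive; [n >= a1^-1] gives [k1 >= 1], so
   that rounding a level costs at most a factor 4. *)
exists (maxn 3 (Num.bound a1^-1)) => n k1 k2 k3.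
rewrite geq_max => /andP[n3 na1] k12 k23 /andP[k1_lo k1_hi] /andP[_ k2_hi].
move=> /andP[k3_lo k3_hi] f fH d T P X [indepX lawX]; cbv zeta.
pose phi w := phi_hat k1 k2 k3 (fun i => X i w); rewrite -/phi.
have n3R : 3 <= n%:R :> R by rewrite ler_nat.
have k1_ge1 : 1 <= k1.
  apply: le_trans k1_lo; rewrite -ler_pdivrMl // mulr1.
  have /archi_boundP/ltW/le_trans : 0 <= a1^-1 by rewrite invr_ge0 ltW.
  by apply; rewrite ler_nat.
have [rate3 rate2] := powR_rates beta0 (le_trans (ler1n R 3) n3R : 1 <= n%:R).
have k3_le : k3 <= A3 * n%:R ^+ 2.
  by apply: le_trans k3_hi _; rewrite ler_wpM2l // ltW.
have k13_le : k1 * k3 <= Q * (n%:R * k3).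
  rewrite mulrA ler_wpM2r //; first lra.
  by apply: le_trans k1_hi _; rewrite ler_wpM2r // lerDl invr_ge0 ltW.
have k2_le : k2 ^+ 2 <= Q * (n%:R * k3).
  have : k2 ^+ 2 <= n%:R * n%:R `^ (2 / (1 + 4 * beta)).
    by rewrite -rate2 lerXn2r ?nnegrE ?powR_ge0 //; lra.
  move=> /le_trans; apply; rewrite mulrCA ler_wpM2l //.
  apply: (@le_trans _ _ (a3^-1 * k3)); first by rewrite ler_pdivlMl.
  by rewrite ler_wpM2r ?lerDr //; [lra|rewrite ltW].
have a1n : a1 * n%:R <= k3 by lra.
have [m1_gt0 m1_le] := next_pow2_bounds k1_ge1.
have [m2_gt0 m2_le] := next_pow2_bounds (le_trans k1_ge1 k12).
have [m3_gt0 m3_le] := next_pow2_bounds (le_trans k1_ge1 (le_trans k12 k23)).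
(* The bins at the three levels jointly determine all three kernels. *)
pose D := (option 'I_(next_pow2 k1) * option 'I_(next_pow2 k2) *
  option 'I_(next_pow2 k3))%type.
pose B (x : R) : D := (bin _ x, bin _ x, bin _ x).
have mB y : measurable (B @^-1` [set y]).
  case: y => -[u v] w.
  rewrite (_ : _ @^-1` _ = bin _ @^-1` [set u] `&` bin _ @^-1` [set v] `&` bin _ @^-1` [set w]).
    by apply: measurableI; [apply: measurableI|]; exact: measurable_preimage_bin.
  by apply/seteqP; split=> x /=; [case=> <- <- <-|case=> -[<- <-] <-].
(* The observations share one law, so the first of them defines the weight [p]. *)
pose i0 : 'I_n := Ordinal (ltn_trans (isT : (0 < 2)%N) n3).
pose p (y : D) := fine (P (X i0 @^-1` (B @^-1` [set y]))).
have mX i A : measurable A -> measurable (X i @^-1` A).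
  by move=> mA; rewrite -[_ @^-1` _]setTI; apply: measurable_funPT.
have law i y : P (X i @^-1` (B @^-1` [set y])) = (p y)%:E.
  rewrite fineK; last by rewrite fin_num_measure //; exact: mX.
  rewrite -[LHS]/(distribution P (X i) _) -[RHS]/(distribution P (X i0) _).
  by rewrite !lawX.
have p_ge0 y : 0 <= p y by rewrite fine_ge0.
have PT : (P setT < +oo)%E by rewrite probability_setT ltry.
have p_sum1 : \sum_y p y = 1.
  apply: EFin_inj; transitivity (\int[P]_(w in setT) 1%:E)%E; last first.
    by rewrite integral_cst //= probability_setT mule1.
  rewrite (integral_finite_image (b := B \o X i0) (fun=> 1) measurableT PT).
    congr (_%:E); apply: eq_bigr => y _.
    by rewrite mul1r setTI comp_preimage.
  by move=> y; rewrite comp_preimage; exact: mX.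
set M := sup_norm01 f.
have f_le x : x \in `[0, 1] -> 0 <= f x <= M.
  move=> x01; have [_ /(_ x x01) /andP[fx _] _] := fH.
  rewrite (le_trans (ltW Mlow0) fx) /=.
  exact: le_trans (ler_norm _) (le_sup_norm01 fH x01).
have M0 : 0 <= M.
  have /andP[f0 fM] := f_le 0 ltac:(by rewrite in_itv /= lexx ler01).
  exact: le_trans fM.
pose kap1 (y z : D) : R := bin_kernel y.1.1 z.1.1.
pose kap2 (y z : D) : R := bin_kernel y.1.2 z.1.2.
pose kap3 (y z : D) : R := bin_kernel y.2 z.2.
have kap_le m' (k : R) (pr : D -> option 'I_m') : (0 < m')%N -> m'%:R <= 4 * k ->
    (forall x, pr (B x) = bin m' x) ->
    kernel_le (lebesgue_mass B) p (fun y z => bin_kernel (pr y) (pr z)) (4 * k) 1 M.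
  move=> m'0 m'k prB; apply: (kernel_le_mono m'k (lexx _) (lexx _)).
  exact: (bin_kernel_kernel_le mB (law i0) m'0 prB (lawX i0) M0 f_le).
pose H := phi_kernel (lebesgue_mass B) kap1 kap2 kap3.
have q_ge0 y : 0 <= lebesgue_mass B y by rewrite fine_ge0.
have k1_ge0 : 0 <= k1 by lra.
have H_le : marginals_le (p := p) H (1408 * (Q * (n%:R * k3))) (352 * M * k3) (88 * M ^+ 2).
  apply: (phi_kernel_marginals q_ge0 p_ge0 M0 k1_ge0 k12 k23) => //.
  - exact: (kap_le _ _ (fun y => y.1.1)).
  - exact: (kap_le _ _ (fun y => y.1.2)).
  - exact: (kap_le _ _ (fun y => y.2)).
pose Cn : R := (n%:R * (n%:R - 1) * (n%:R - 2))^-1.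
pose Phi (c : {ffun 'I_n -> D}) := Cn * \sum_(b | distinct3 b) lift3 H b c.
have phiE : phi = fun w => Phi [ffun i => B (X i w)].
  apply/funext => w; rewrite /phi.
  rewrite (phi_hat_lift3 mB (kap1 := kap1) (kap2 := kap2) (kap3 := kap3)) //;
    by move=> x y; rewrite /haar_kernel haar_kernel_binE.
have Ephi : fine 'E_P[phi]%E = Cn * \sum_(b : 'I_n * 'I_n * 'I_n | distinct3 b) mean3 (p := p) H.
  rewrite phiE (expectation_bins mB indepX law) /= expectZ expect_sum; congr (_ * _).
  by apply: eq_bigr => b /(expect_lift3_mean p_sum1).
rewrite Ephi phiE.
pose a := k3 / n%:R ^+ 2.
have a0 : 0 < a by rewrite divr_gt0 ?exprn_gt0 //; lra.
(* [Y] is the deviation of the estimator from its mean, as a function of the bins. *)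
pose Y (c : {ffun 'I_n -> D}) := Cn * \sum_(b | distinct3 b) (lift3 H b c - mean3 (p := p) H).
pose F c := (Y c ^+ 2) `^ q.
rewrite (_ : (fun w => _) = (fun w => F [ffun i => B (X i w)])); last first.
  by apply/funext => w; rewrite /F /Phi /Y sumrB mulrBr.
rewrite (expectation_bins mB indepX law F) lee_fin.
(* With [t = Y ^+ 2], what remains is the moment of order [2 * m], whose bound of order [a ^+ m]
   cancels [a^-1 ^+ m]. *)
apply: (@le_trans _ _ (expect (p := p) (fun c => a `^ q * (1 + (a^-1 * Y c ^+ 2) ^+ m)))).
  by apply: ler_expect => // c; apply: powR_le_add_exp => //; exact: sqr_ge0.
rewrite expectZ expectD expect_cst // mulrC ler_wpM2r ?powR_ge0 // lerD2l.
rewrite (eq_expect (g' := fun c => a^-1 ^+ m * Y c ^+ (2 * m))); last first.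
  by move=> c; rewrite exprMn exprM.
rewrite expectZ exprVn -ler_pdivlMl ?invr_gt0 ?exprn_gt0 // invrK mulrC -exprMn.
exact: ustat_moment_le.
Qed.
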